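(* For $M,L>0$ let $$A^{(n)}_{M,L}=\{\sigma\in S_n:\ \sigma_j\le Mn^{1/2}\ \text{for some}\ j\le L\}$$ be the event that a card with number less than or equal to $Mn^{1/2}$ appears in one of the first $L$ positions. Then for all sufficiently large $C$, $$\lim_{M\to\infty}\lim_{n\to\infty}p_n(\mathrm{id},A^{(n)}_{M,CM^2})=1.$$ In particular, $$\lim_{n\to\infty}\|p_n(\mathrm{id},\cdot)-U_n\|_{\mathrm{TV}}=1,$$ where $U_n$ is the uniform probability measure on $S_n$.
   Context: A permutation $\sigma\in S_n$ is viewed as a deck of cards numbered $1,\dots,n$ laid out in a row, where $\sigma_j$ is the number of the card in the $j$-th position from the left. The card-cyclic to random insertion shuffle removes each of the $n$ cards exactly once and immediately reinserts it in a position chosen uniformly from the $n$ possible positions (independently of the other insertions); the removals and reinsertions are performed one card at a time in the original left-to-right order of the cards. Starting from the identity $\mathrm{id}$ (cards in increasing order from left to right), the cards are thus removed and reinserted in the order $1,2,\dots,n$, and after card $j$ is reinserted in ''position $k$'' it is the $k$-th card from the left. $p_n(\mathrm{id},\cdot)$ denotes the distribution on $S_n$ of the deck after one such shuffle started from $\mathrm{id}$. The total variation norm between probability measures $\mu,\nu$ on $S_n$ is $\|\mu-\nu\|_{\mathrm{TV}}=\sup_{A\subset S_n}(\mu(A)-\nu(A))=\frac12\sum_{\sigma\in S_n}|\mu(\sigma)-\nu(\sigma)|$. *)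

(* Defs.v *)
From HB Require Import structures.
From mathcomp Require Import all_boot all_order all_algebra all_fingroup.
From mathcomp Require Import boolp classical_sets reals topology normedtype.
From mathcomp Require Import sequences.
Set Implicit Arguments.
Unset Strict Implicit.
Unset Printing Implicit Defensive.
Import Order.TTheory GRing.Theory Num.Theory.
Import numFieldNormedType.Exports.
Local Open Scope ring_scope.

(* A deck of n cards is a permutation s : 'S_n, with s i the card in position
   i.  Both cards and positions are elements of 'I_n, hence numbered from 0:
   the 1-based numbers of card c and position i are c.+1 and i.+1. *)
Definition deck (n : nat) (s : 'S_n) : seq 'I_n := [seq s i | i <- enum 'I_n].

(* When c occurs in d and k < size d, the index of c in the result is k. *)
Definition reinsert (T : eqType) (c : T) (k : nat) (d : seq T) : seq T :=
  take k (rem c d) ++ c :: drop k (rem c d).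

(* The cards s 0, s 1, ... are moved in their original left-to-right order,
   the i-th of them to position k i. *)
Definition shuffle (n : nat) (s : 'S_n) (k : {ffun 'I_n -> 'I_n}) :
    seq 'I_n :=
  foldl (fun d i => reinsert (s i) (k i) d) (deck s) (enum 'I_n).

(* p_n(s, t): independent uniform insertion positions amount to a uniform
   k : {ffun 'I_n -> 'I_n}. *)
Definition card_cyclic (R : realType) (n : nat) (s t : 'S_n) : R :=
  #|[pred k : {ffun 'I_n -> 'I_n} | shuffle s k == deck t]|%:R
    / #|{ffun 'I_n -> 'I_n}|%:R.

Definition uniform_deck (R : realType) (n : nat) (t : 'S_n) : R := #|'S_n|%:R^-1.

(* The measure of the event A under the distribution with mass function mu. *)
Definition Pr (R : realType) (T : finType) (mu : T -> R) (A : {set T}) : R :=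
  \sum_(t in A) mu t.

Definition tv_dist (R : realType) (T : finType) (mu nu : T -> R) : R :=
  sup (range (fun A : {set T} => Pr mu A - Pr nu A)).

Definition low_card_on_top (R : realType) (n : nat) (M L : R) : {set 'S_n} :=
  [set s : 'S_n | [exists j : 'I_n,
    (j.+1%:R <= L) && ((s j).+1%:R <= M * Num.sqrt n%:R)]]%SET.

(* Main.v *)
(* Inserting card c at a uniform position is the same as putting it directly in
   front of a uniformly chosen parent card v_c (v_c = c standing for the end of
   the deck), and the parents are independent.  On the time scale T = B sqrt n,
   up to an event of probability at most T^3/n^2, the moved cards in front of the
   first unmoved card s are exactly those with c < v_c <= s, in order of arrival.
   Hence, cutting [0, T] into
   blocks, the number of cards in front of the first low card (number at most
   m = M sqrt n) lies between the numbers of high arrivals before and after the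
   block in which a low card first arrives; the arrivals of low and of high cards
   are independent, with Poisson limits.  After time T the number j of cards in
   front of the first low card is a Markov chain, j -> j + 1 with probability
   (j + 1)/n.  Refining the blocks squeezes the probability of the event and gives
   the existence of the limit in n; the single block [0, m] gives the lower bound
   1 - exp(-M^2/2) - e/(K + 1) with K = floor (C M^2), by Markov's inequality.
   Under the uniform measure the event has probability at most K m/n -> 0. *)
Require Import Defs.
From HB Require Import structures.
From mathcomp Require Import all_boot all_order all_algebra all_fingroup.
From mathcomp Require Import boolp classical_sets reals topology normedtype.
From mathcomp Require Import sequences exp.
From mathcomp Require Import zify ring lra.
Set Implicit Arguments.
Unset Strict Implicit.
Unset Printing Implicit Defensive.
Import Order.TTheory GRing.Theory Num.Theory.
Import numFieldNormedType.Exports.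
Local Open Scope classical_set_scope.
Local Open Scope ring_scope.

(** * The deck as a function of the parents *)

Lemma index_rem (T : eqType) (x c : T) (d : seq T) : x != c ->
  (index x (rem c d) = index x d - (index c d < index x d))%N.
Proof.
move=> xc; elim: d => [|y d IH] //=.
case: (eqVneq y c) => [->|yc] /=; first by rewrite (eq_sym c) (negPf xc) ltn0Sn subn1.
by case: (eqVneq y x) => [_|yx]; [rewrite ltn0 | rewrite IH; lia].
Qed.

Lemma index_reinsert (T : eqType) (x c : T) k (d : seq T) :
  (k <= size (rem c d))%N -> x != c ->
  (index x (reinsert c k d) = index x (rem c d) + (k <= index x (rem c d)))%N.
Proof.
rewrite /reinsert; set r := rem c d => kr xc.
have e : index x r = index x (take k r ++ drop k r) by rewrite cat_take_drop.
move: e; rewrite !index_cat in_take_leq // size_take_min (minn_idPl kr) /=.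
by rewrite (eq_sym c) (negPf xc); case: ltnP => h e; lia.
Qed.

Lemma index_reinsert_self (T : eqType) (c : T) k (d : seq T) :
  uniq d -> (k <= size (rem c d))%N -> index c (reinsert c k d) = k.
Proof.
move=> ud kr; rewrite /reinsert index_cat.
have /negPf -> : c \notin take k (rem c d).
  by apply/negP => /mem_take; rewrite mem_rem_uniqF.
by rewrite /= eqxx addn0 size_take_min; apply/minn_idPl.
Qed.

Lemma perm_reinsert (T : eqType) (c : T) k (d : seq T) :
  c \in d -> perm_eq (reinsert c k d) d.
Proof.
move=> cd; rewrite [perm_eq _ d]perm_sym (perm_trans (perm_to_rem cd)) //.
by rewrite perm_sym /reinsert -cat1s perm_catCA cat_take_drop.
Qed.

(* The insertion of card [t] is encoded by the card [a t] it is put in front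
   of; as [t] is not in [rem t d], the value [a t = t] encodes the end of the
   deck. *)
Fixpoint deck_at (n : nat) (a : nat -> nat) (t : nat) : seq nat :=
  if t is s.+1 then
    let d := deck_at n a s in reinsert s (index (a s) (rem s d)) d
  else iota 0 n.

Lemma eq_deck_at n (a b : nat -> nat) t :
  (forall s, s < t -> a s = b s)%N -> deck_at n a t = deck_at n b t.
Proof.
elim: t => //= t IH ab; rewrite IH ?ab // => s st; apply: ab; lia.
Qed.

Lemma perm_deck_at n a t : (t <= n)%N -> perm_eq (deck_at n a t) (iota 0 n).
Proof.
elim: t => //= t IH tn; have p := IH (ltnW tn).
by apply: (perm_trans _ p); apply: perm_reinsert; rewrite (perm_mem p) mem_iota.
Qed.

(** * Relative order of the cards for fixed parents *)

Section Order.
Variables (n : nat) (a : nat -> nat).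
Local Notation D := (deck_at n a).
Hypothesis an : forall c, (c < n -> a c < n)%N.

Lemma uniq_deck_at t : (t <= n)%N -> uniq (D t).
Proof. by move=> tn; rewrite (perm_uniq (perm_deck_at a tn)) iota_uniq. Qed.

Lemma size_deck_at t : (t <= n)%N -> size (D t) = n.
Proof. by move=> tn; rewrite (perm_size (perm_deck_at a tn)) size_iota. Qed.

Lemma mem_deck_at t x : (t <= n)%N -> (x \in D t) = (x < n)%N.
Proof. by move=> tn; rewrite (perm_mem (perm_deck_at a tn)) mem_iota. Qed.

Lemma size_rem_deck_at t : (t < n)%N -> size (rem t (D t)) = n.-1.
Proof.
by move=> tn; rewrite size_rem ?size_deck_at // ?mem_deck_at // ltnW.
Qed.

Lemma index_deck_at_lt t x : (t <= n)%N -> (index x (D t) < n)%N = (x < n)%N.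
Proof. by move=> tn; rewrite -[X in (_ < X)%N = _](size_deck_at tn) index_mem mem_deck_at. Qed.

Lemma index_rem_deck_at_lt t x : (t < n)%N ->
  (index x (rem t (D t)) < n.-1)%N = (x < n)%N && (x != t).
Proof.
move=> tn; rewrite -(size_rem_deck_at tn) index_mem mem_rem_uniq ?inE.
  by rewrite andbC mem_deck_at // ltnW.
exact: uniq_deck_at (ltnW tn).
Qed.

Lemma index_deck_at_inj t x y : (t <= n)%N -> (x < n)%N ->
  index x (D t) = index y (D t) -> x = y.
Proof.
move=> tn xn e; have yn : (y < n)%N by rewrite -(index_deck_at_lt y tn) -e index_deck_at_lt.
by apply: (index_inj 0%N) e; rewrite ?mem_deck_at.
Qed.

(** The removed card [t] gets the index [n.-1], the size of [rem t (D t)], which no other card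
    takes. So cards and insertion slots correspond one to one. *)
Lemma index_rem_deck_at_inj t x y : (t < n)%N -> (x < n)%N -> (y < n)%N ->
  index x (rem t (D t)) = index y (rem t (D t)) -> x = y.
Proof.
move=> tn xn yn ei; have := index_rem_deck_at_lt y tn.
rewrite -ei index_rem_deck_at_lt // xn yn /= => h.
have [e1|ne1] := eqVneq x t; first by move: h; rewrite e1 eqxx => /esym/negbFE/eqP.
have mr z : (z < n)%N -> z != t -> z \in rem t (D t).
  by move=> zn zt; rewrite mem_rem_uniq ?uniq_deck_at ?(ltnW tn) // !inE zt
    mem_deck_at // ltnW.
by apply: (index_inj 0%N) ei; apply: mr; rewrite -?h.
Qed.

Lemma index_deck_atS t x : (t < n)%N -> x != t ->
  let r := rem t (D t) in
  (index x (D t.+1) = index x r + (index (a t) r <= index x r))%N.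
Proof. by move=> tn xt /=; rewrite index_reinsert // index_size. Qed.

Lemma index_deck_atS_self t : (t < n)%N ->
  index t (D t.+1) = index (a t) (rem t (D t)).
Proof.
move=> tn; rewrite /= index_reinsert_self ?index_size //.
exact: uniq_deck_at (ltnW tn).
Qed.

(** The initial deck is increasing, and moving card [t] does not change the relative order of two
    other cards. *)
Lemma index_unmoved t u w : (t <= u)%N -> (u < w)%N -> (w < n)%N ->
  (index u (D t) < index w (D t))%N.
Proof.
elim: t u w => [|t IH] u w tu uw wn.
  have io x : (x < n)%N -> index x (iota 0 n) = x.
    by move=> xn; rewrite -{1}[x](nth_iota 0 0 xn) index_uniq ?iota_uniq ?size_iota.
  by rewrite /= !io //; lia.
have tn : (t < n)%N by lia.
have ut : u != t by apply/negP => /eqP; lia.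
have wt : w != t by apply/negP => /eqP; lia.
rewrite !index_deck_atS // (index_rem _ ut) (index_rem _ wt).
have := IH u w (ltnW tu) uw wn; have := IH t u (leqnn t) tu (ltn_trans uw wn).
have := IH t w (leqnn t) (ltn_trans tu uw) wn; lia.
Qed.

(* Up to time [T], no card is inserted directly in front of a moved card that
   is in front of card [T]. *)
Definition good (T : nat) : Prop :=
  forall c' c, (c' < c < T)%N -> a c = c' -> ~~ (c' < a c' <= T)%N.

(** After [c] has moved, neither it nor [u] moves before time [t], so only the step that inserts [c]
    matters. A parent not yet moved is [u] or lies in front of [u] exactly when it is at most [u];
    the parent [c] itself means the end of the deck; a moved parent lies behind [u] by [good] and
    induction. *)
Lemma before_unmoved T t c u : good T -> (T < n)%N -> (c < t)%N ->
  (t <= u <= T)%N ->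
  (index c (D t) < index u (D t))%N = (c < a c <= u)%N.
Proof.
move=> gT Tn; elim: t c u => // t IH c u ct /andP[tu uT].
have tn : (t < n)%N by lia.
have un : (u < n)%N by lia.
have ut : u != t by apply/negP => /eqP; lia.
have itu : (index t (D t) < index u (D t))%N by apply: index_unmoved.
have [e|ct'] := eqVneq c t; last first.
  rewrite !index_deck_atS // -(IH c u); last 2 first.
  - by rewrite ltn_neqAle ct'.
  - lia.
  have ne : index c (D t) <> index t (D t).
    by move=> /index_deck_at_inj e; case/eqP: ct'; apply: e; lia.
  have ne' : index c (D t) <> index u (D t).
    by move=> /index_deck_at_inj e; have : c = u by [apply: e; lia]; lia.
  rewrite (index_rem _ ct') (index_rem _ ut); lia.
subst c; rewrite index_deck_atS_self // index_deck_atS //.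
set r := rem t (D t); set p := a t.
(* Card [u] is shifted if [t] lands in front of it; equality is the case [p = u], where [t] goes
   directly in front of [u]. *)
have -> : (index p r < index u r + (index p r <= index u r))%N =
  (index p r <= index u r)%N by lia.
have pn : (p < n)%N := an tn.
have ur : (index u r < n.-1)%N by rewrite index_rem_deck_at_lt // un.
case: (ltngtP p t) => [pt|tp|pt].
- rewrite /=; have nb : ~~ (index p (D t) < index u (D t))%N.
    rewrite IH //; last lia.
    have : ~~ (p < a p <= T)%N by apply: (gT p t); rewrite ?pt //=; lia.
    lia.
  have ne : index p (D t) <> index u (D t).
    by move=> /index_deck_at_inj e; have : p = u by [apply: e; lia]; lia.
  have pt' : p != t by apply/negP => /eqP; lia.
  by rewrite (index_rem _ pt') (index_rem _ ut); lia.
- have pt : p != t by apply/negP => /eqP; lia.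
  have := @index_unmoved t t p (leqnn t) tp pn.
  rewrite /= (index_rem _ pt) (index_rem _ ut).
  case: (ltngtP p u) => [pu|up|->]; last by lia.
    by have := @index_unmoved t p u (ltnW tp) pu un; lia.
  by have := @index_unmoved t u p (ltnW tu) up pn; lia.
- rewrite /= pt; have := index_rem_deck_at_lt t tn; rewrite eqxx andbF -/r; lia.
Qed.

(** Only a parent in front of card [t] could bring it into this prefix. Such a parent would be a
    moved card, and by [before_unmoved] it would form with [t] a pair that [good] forbids. *)
Lemma front_prefix_step T t : good T -> (T < n)%N -> (t < T)%N ->
  take (index t (D t)) (D t.+1) = take (index t (D t)) (D t) /\
  (index t (D t) <= index t.+1 (D t.+1))%N.
Proof.
move=> gT Tn tT; have tn : (t < n)%N by lia.
have tn1 : (t.+1 < n)%N by lia.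
have lt1 := @index_unmoved t t t.+1 (leqnn _) (ltnSn _) tn1.
split; last first.
  have tt : t.+1 != t by apply/negP => /eqP; lia.
  by rewrite index_deck_atS // (index_rem _ tt); lia.
have le : (index t (D t) <= index (a t) (rem t (D t)))%N.
  have [e|ne] := eqVneq (a t) t.
    have := index_rem_deck_at_lt t tn; rewrite eqxx andbF e.
    have := index_deck_at_lt t (ltnW tn); lia.
  have an' := an tn; rewrite index_rem //; case: (ltnP (a t) t) => h.
    have : ~~ (index (a t) (D t) < index t (D t))%N.
      rewrite (before_unmoved gT) //; last lia.
      have : ~~ (a t < a (a t) <= T)%N by apply: (gT _ t); rewrite ?h.
      lia.
    have : index (a t) (D t) <> index t (D t).
      by move=> /index_deck_at_inj e; move/eqP: ne; apply; apply: e; lia.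
    lia.
  by have := @index_unmoved t t (a t) (leqnn _); lia.
rewrite /= /reinsert takel_cat; last first.
  by rewrite size_take_min leq_min le (leq_trans le (index_size _ _)).
rewrite take_takel // remE takel_cat ?take_takel //.
by rewrite size_take_min leq_min leqnn index_size.
Qed.

(** Iterating the one-step version, the arrivals queue up in order: what is ahead of [s] at time [s]
    is settled until time [T]. *)
Lemma front_prefix T s t : good T -> (T < n)%N -> (s <= t <= T)%N ->
  take (index s (D s)) (D t) = take (index s (D s)) (D s) /\
  (index s (D s) <= index t (D t))%N.
Proof.
move=> gT Tn /andP[]; elim: t => [|t IH]; first by rewrite leqn0 => /eqP ->.
rewrite leq_eqVlt => /predU1P[->//|st] tT.
have [e le] := IH st (ltnW tT).
have [e1 le1] := front_prefix_step gT Tn tT; split; last by lia.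
by rewrite -e -(take_takel (D t) le) -e1 take_takel.
Qed.

Definition front (s : nat) := take (index s (D s)) (D s).

Lemma perm_front T s : good T -> (T < n)%N -> (s <= T)%N ->
  perm_eq (front s) [seq c <- iota 0 n | (c < a c <= s) && (c < s)]%N.
Proof.
move=> gT Tn sT; have sn : (s <= n)%N by lia.
apply: uniq_perm; rewrite ?filter_uniq ?iota_uniq ?take_uniq ?uniq_deck_at //.
move=> c; rewrite mem_filter mem_iota add0n /=.
rewrite in_take_leq ?index_size //.
case: (ltnP c s) => cs.
  by rewrite (before_unmoved gT) ?leqnn //; lia.
rewrite andbF /=; apply/negbTE; rewrite -leqNgt.
case: (ltnP c n) => cn.
  by case: (ltngtP s c) cs => // [h|->] _; rewrite // ltnW // index_unmoved.
have := index_deck_at_lt c sn; have := index_deck_at_lt s sn; lia.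
Qed.

(* On [good T], the cards in front of card [s] just before it is moved are those
   with [c < a c <= s]: [no_low] says that none of them is numbered less than
   [m], and [highs] counts those numbered at least [m]. *)
Definition no_low (m s : nat) : bool := ~~ has (fun c => c < a c <= s)%N (iota 0 m).
Definition highs (m s : nat) : nat :=
  count (fun c => (m <= c) && (c < a c <= s))%N (iota 0 n).
Definition first_low (m t : nat) : nat := find (fun c => c < m)%N (D t).

Lemma size_front s : (s <= n)%N -> size (front s) = index s (D s).
Proof. by move=> sn; rewrite size_take_min; apply/minn_idPl/index_size. Qed.

Lemma front_has_low T m s : good T -> (m <= n)%N -> (T < n)%N -> (s <= T)%N ->
  has (fun c => c < m)%N (front s) = ~~ no_low m s.
Proof.
move=> gT mn Tn sT; rewrite negbK (eq_has_r (perm_mem (perm_front gT Tn sT))).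
apply/hasP/hasP => -[c]; rewrite ?mem_filter !mem_iota !add0n => h1 h2.
  exists c; rewrite ?mem_iota; lia.
by exists c; rewrite ?mem_filter ?mem_iota; lia.
Qed.

(** At time [T] the deck still begins with [front s], which holds no low card; by [perm_front] its
    length is at least [highs m s]. *)
Lemma first_low_ge T m s : good T -> (m <= n)%N -> (T < n)%N -> (s <= T)%N ->
  no_low m s -> (highs m s <= first_low m T)%N.
Proof.
move=> gT mn Tn sT nl; have sn : (s <= n)%N by lia.
apply: (@leq_trans (index s (D s))); last first.
  have sTT : (s <= T <= T)%N by rewrite sT /=.
  have sz : (index s (D s) <= size (D T))%N.
    by rewrite (leq_trans (index_size _ _)) // !size_deck_at // ltnW.
  rewrite leqNgt -has_take_leq //; have [-> _] := front_prefix gT Tn sTT.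
  by rewrite -/(front s) (front_has_low gT) // nl.
rewrite -size_front // (perm_size (perm_front gT Tn sT)) size_filter.
by apply: sub_count => c /=; lia.
Qed.

(** A low card in [front s] is still in this prefix at time [T], so the cards ahead of the first low
    card are high members of [front s]. *)
Lemma first_low_le T m s : good T -> (m <= n)%N -> (T < n)%N -> (s <= T)%N ->
  ~~ no_low m s -> (first_low m T <= highs m s)%N.
Proof.
move=> gT mn Tn sT nl; have sn : (s <= n)%N by lia.
have hl : has (fun c => c < m)%N (front s) by rewrite (front_has_low gT).
have -> : first_low m T = find (fun c => c < m)%N (front s).
  have sTT : (s <= T <= T)%N by rewrite sT /=.
  have [e _] := front_prefix gT Tn sTT.
  rewrite /front -e /first_low -{1}(cat_take_drop (index s (D s)) (D T)).
  by rewrite find_cat e -/(front s) hl.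
have fc (P : pred nat) (l : seq nat) : (find P l <= count (predC P) l)%N.
  by elim: l => //= x l IH; case: ifP => //=; lia.
apply: leq_trans (fc _ _) _.
rewrite (seq.permP (perm_front gT Tn sT)) count_filter.
by apply: sub_count => c /=; lia.
Qed.

Lemma first_low_lt T m : good T -> (m <= n)%N -> (T < n)%N ->
  ~~ no_low m T -> (first_low m T < index T (D T))%N.
Proof.
move=> gT mn Tn nl; have sn : (T <= n)%N by lia.
by rewrite -has_take_leq ?index_size // -/(front T) (front_has_low gT).
Qed.

(** For [m <= t] the moving card is high, and it is taken from behind the first low card. Only its
    reinsertion can push that card back, by one place. *)
Lemma first_low_step m t : (m <= t)%N -> (t < n)%N ->
  (first_low m t < index t (D t))%N ->
  first_low m t.+1 =
    (first_low m t + (index (a t) (rem t (D t)) <= first_low m t))%N.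
Proof.
move=> mt tn lt; set P := (fun c => c < m)%N.
have er : find P (rem t (D t)) = first_low m t.
  rewrite remE find_cat; have hl : has P (take (index t (D t)) (D t)).
    by rewrite has_take_leq ?index_size.
  rewrite hl /first_low -[in RHS](cat_take_drop (index t (D t)) (D t)).
  by rewrite find_cat hl.
rewrite /first_low /= /reinsert -/P.
set i := index _ _; set r := rem t (D t) in i er *.
have ir : (i <= size r)%N by rewrite index_size.
have := er; rewrite -{1}(cat_take_drop i r) !find_cat has_take_leq // er.
have Pt : P t = false by apply/negbTE; rewrite -leqNgt.
by rewrite /= Pt size_take_min (minn_idPl ir) /first_low -/P; case: ltnP; lia.
Qed.

Lemma first_low_unmoved_step m t : (m <= t)%N -> (t < n)%N ->
  (forall u, (t <= u < n)%N -> (first_low m t < index u (D t))%N) ->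
  forall u, (t < u < n)%N -> (first_low m t.+1 < index u (D t.+1))%N.
Proof.
move=> mt tn h u /andP[tu un]; rewrite first_low_step ?h ?leqnn //.
have ut : u != t by apply/negP => /eqP; lia.
rewrite index_deck_atS // (index_rem _ ut).
have := @index_unmoved t t u (leqnn _) tu un.
have := h t; have := h u; lia.
Qed.

(** At time [T] a low card is in front of card [T], hence of all unmoved cards. This persists: an
    insertion that pushes the first low card back pushes every unmoved card behind it back as
    well. *)
Lemma first_low_unmoved T m t u : good T -> (m <= T)%N -> (T < n)%N ->
  ~~ no_low m T -> (T <= t)%N -> (t <= u < n)%N ->
  (first_low m t < index u (D t))%N.
Proof.
move=> gT mT Tn nl; elim: t u => [|t IH] u.
  rewrite leqn0 => /eqP T0; subst T; rewrite leqn0 in mT.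
  by move: nl; rewrite /no_low (eqP mT).
have base w : (T <= w < n)%N -> (first_low m T < index w (D T))%N.
  move=> /andP[Tw wn]; have lt := @first_low_lt T m gT (leq_trans mT (ltnW Tn)) Tn nl.
  case: (ltngtP T w) Tw => // [h|<-] _ //.
  by apply: ltn_trans lt _; apply: index_unmoved.
rewrite leq_eqVlt => /predU1P[<-|Tt] h; first exact: base.
apply: first_low_unmoved_step => //; [lia|lia|move=> w hw].
by apply: IH; lia.
Qed.

End Order.

(** * Uniform parents *)

Lemma nth_deck n (s : 'S_n) (i0 i : 'I_n) : nth i0 (deck s) i = s i.
Proof. by rewrite /deck (nth_map i0) ?nth_ord_enum ?size_enum_ord. Qed.

Lemma size_deck n (s : 'S_n) : size (deck s) = n.
Proof. by rewrite /deck size_map size_enum_ord. Qed.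

Lemma uniq_deck n (s : 'S_n) : uniq (deck s).
Proof. by rewrite map_inj_uniq ?enum_uniq //; exact: perm_inj. Qed.

Lemma deck_inj n : injective (@deck n).
Proof.
move=> s t e; apply/permP => i.
by rewrite -[LHS](nth_deck s i) -[RHS](nth_deck t i) e.
Qed.

Section Parents.
Variable n : nat.
Implicit Type v : {ffun 'I_n -> 'I_n}.

Definition parent v (i : nat) : nat := if insub i is Some j then v j else 0%N.

Lemma parentE v (c : 'I_n) : parent v c = v c.
Proof. by rewrite /parent valK. Qed.

Lemma parent_lt v i : (i < n)%N -> (parent v i < n)%N.
Proof. by move=> lin; rewrite (parentE v (Ordinal lin)). Qed.

(** The insertion positions that realise the parents [v]. The default of [insubd] is never taken, by
    [val_position]. *)
Definition position v : {ffun 'I_n -> 'I_n} :=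
  [ffun i : 'I_n => insubd i (index (v i : nat) (rem (i : nat) (deck_at n (parent v) i)))].

Lemma val_position v i :
  position v i = index (v i : nat) (rem (i : nat) (deck_at n (parent v) i)) :> nat.
Proof.
rewrite ffunE; apply: (insubdK i).
rewrite unfold_in (leq_ltn_trans (index_size _ _)) //.
by rewrite size_rem_deck_at ?ltn_ord //; case: (n) i => [[]|].
Qed.

Lemma map_val_rem (c : 'I_n) (d : seq 'I_n) :
  map val (rem c d) = rem (val c) (map val d).
Proof. by elim: d => //= x d <-; rewrite val_eqE; case: eqP. Qed.

Lemma shuffle_position v :
  map val (shuffle 1%g (position v)) = deck_at n (parent v) n.
Proof.
rewrite /shuffle /deck.
have -> : [seq (1%g : 'S_n) i | i <- enum 'I_n] = enum 'I_n.
  by rewrite -[RHS]map_id; apply: eq_map => i; rewrite perm1.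
pose f (d : seq 'I_n) i := reinsert ((1%g : 'S_n) i) (position v i) d.
rewrite -/f.
suff H t : (t <= n)%N ->
    map val (foldl f (enum 'I_n) (take t (enum 'I_n))) = deck_at n (parent v) t.
  by rewrite -(H n) // take_oversize // size_enum_ord.
elim: t => [|t IH] tn; first by rewrite take0 /= val_enum_ord.
pose c := Ordinal tn.
rewrite (take_nth c) ?size_enum_ord // foldl_rcons /= -IH ?(ltnW tn) //.
have -> : nth c (enum 'I_n) t = c by apply: val_inj; rewrite /= nth_enum_ord.
rewrite {1}/f /reinsert perm1 val_position /= -IH ?(ltnW tn) //.
by rewrite map_cat /= map_take map_drop map_val_rem (parentE v c).
Qed.

(** The parents below [t] determine the deck at time [t], and there distinct parents give distinct
    slots. An injective self-map of a finite set is a bijection, so uniform positions amount to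
    uniform parents. *)
Lemma position_inj : injective position.
Proof.
move=> v v' e.
have H t : (t <= n)%N -> forall s, (s < t)%N -> parent v s = parent v' s.
  elim: t => // t IH tn s; rewrite ltnS leq_eqVlt => /predU1P[->|]; last first.
    by apply: IH; apply: ltnW.
  have dE := @eq_deck_at n _ _ t (IH (ltnW tn)).
  have : position v (Ordinal tn) = position v' (Ordinal tn) :> nat by rewrite e.
  rewrite !val_position /= -dE -!(parentE _ (Ordinal tn)) /=.
  by apply: index_rem_deck_at_inj; rewrite ?parent_lt.
apply/ffunP => c; apply: val_inj; rewrite /= -!parentE.
by apply: (H n).
Qed.

End Parents.

(** * Expectation over independent uniform parents *)

Section Expectation.
Variables (R : realType) (n : nat).
Implicit Types f g : {ffun 'I_n -> 'I_n} -> R.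

Definition Ex f : R := (\sum_v f v) / (n ^ n)%:R.

(** Each choice of positions yields exactly one deck, so the mass of an event is the share of the
    positions leading into it; these are reindexed by the bijection [position]. *)
Lemma Pr_card_cyclic (P : pred (seq nat)) :
  Pr (@card_cyclic R n 1%g) [set s : 'S_n | P (map val (deck s))]%SET =
  Ex (fun v => (P (deck_at n (parent v) n))%:R).
Proof.
rewrite /Pr /card_cyclic /Ex -mulr_suml card_ffun !card_ord; congr (_ / _).
rewrite (eq_bigr (fun t : 'S_n => \sum_(k : {ffun 'I_n -> 'I_n})
   (shuffle 1%g k == deck t)%:R)); last first.
  by move=> t _; rewrite -sum1_card natr_sum big_mkcond; apply: eq_bigr => k _;
     rewrite inE; case: eqP.
rewrite exchange_big /= (reindex_inj (@position_inj n)) /=.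
apply: eq_bigr => v _.
have [p sp] : exists p : 'S_n, shuffle 1%g (position v) = deck p.
  have pe : perm_eq (shuffle 1%g (position v)) (ord_tuple n).
    apply: (perm_map_inj val_inj); rewrite shuffle_position val_enum_ord /=.
    exact: perm_deck_at.
  have /tuple_permP[p ->] := pe; exists p.
  by rewrite /deck; apply: eq_map => i; rewrite tnth_ord_tuple.
rewrite -shuffle_position sp big_mkcond (bigD1 p) //= eqxx inE big1 ?addr0.
  by case: (P _).
move=> t tp; case: ifP => // _; case: eqP => // /deck_inj e.
by rewrite e eqxx in tp.
Qed.

(** As positions are numbered from 0, [j.+1 <= L] becomes [j < truncn L], and likewise for the
    cards. A deck without low card has [first_low] equal to [n], so [truncn L <= n] keeps it out of
    the event. *)
Lemma Pr_low_card (M L : R) : 0 <= M -> 0 <= L ->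
  (Num.truncn L <= n)%N ->
  Pr (@card_cyclic R n 1%g) (low_card_on_top n M L) =
  Ex (fun v => (first_low n (parent v) (Num.truncn (M * Num.sqrt n%:R)) n <
                Num.truncn L)%N%:R).
Proof.
move=> M0 L0 Ln; set m := Num.truncn _; set K := Num.truncn L.
rewrite -(Pr_card_cyclic (fun d => find (fun c => c < m)%N d < K)%N).
congr Pr; apply/setP => s; rewrite !inE.
have sd : size (map val (deck s)) = n by rewrite size_map size_deck.
rewrite -has_take_leq ?sd //.
have nd (i : 'I_n) : nth 0%N (map val (deck s)) i = s i.
  by rewrite (nth_map i) ?nth_deck // size_deck.
apply/existsP/hasP => [[j /andP[jL sjm]]|[c]].
  exists (s j : nat); last by rewrite /m truncn_ge_nat // mulr_ge0 ?sqrtr_ge0.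
  rewrite -nd in_take ?mem_nth ?sd ?ltn_ord //.
  rewrite index_uniq ?sd ?ltn_ord //; first by rewrite /K truncn_ge_nat.
  by rewrite (map_inj_uniq val_inj) uniq_deck.
move=> /(nthP 0%N)[i]; rewrite size_take_min sd leq_min => /andP[iK iN].
rewrite nth_take // (nd (Ordinal iN)) => <- h; exists (Ordinal iN).
by rewrite -truncn_ge_nat // -/K iK /= -truncn_ge_nat ?mulr_ge0 ?sqrtr_ge0.
Qed.

Lemma ExD f g : Ex (fun v => f v + g v) = Ex f + Ex g.
Proof. by rewrite /Ex big_split mulrDl. Qed.

Lemma ExB f g : Ex (fun v => f v - g v) = Ex f - Ex g.
Proof. by rewrite /Ex big_split sumrN mulrDl mulNr. Qed.

Lemma Ex_sum I (r : seq I) (P : pred I) (F : I -> _ -> R) :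
  Ex (fun v => \sum_(i <- r | P i) F i v) = \sum_(i <- r | P i) Ex (F i).
Proof. by rewrite /Ex exchange_big mulr_suml. Qed.

Lemma le_Ex f g : (forall v, f v <= g v) -> Ex f <= Ex g.
Proof. by move=> fg; rewrite ler_wpM2r ?invr_ge0 ?ler0n // ler_sum. Qed.

Lemma eq_Ex f g : f =1 g -> Ex f = Ex g.
Proof. by move=> fg; congr (_ / _); apply: eq_bigr. Qed.

Lemma Ex_cst a : (0 < n)%N -> Ex (fun=> a) = a.
Proof.
move=> n0; rewrite /Ex sumr_const card_ffun !card_ord -[a *+ _]mulr_natr mulfK //.
by rewrite pnatr_eq0 -lt0n expn_gt0 n0.
Qed.

Definition upd (v : {ffun 'I_n -> 'I_n}) (c x : 'I_n) : {ffun 'I_n -> 'I_n} :=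
  [ffun i => if i == c then x else v i].

Lemma parent_upd v (c x : 'I_n) i :
  parent (upd v c x) i = if i == c then x : nat else parent v i.
Proof.
rewrite /parent; case: insubP => [j lt <-|nlt]; first by rewrite ffunE val_eqE; case: eqP.
by case: eqP => // e; rewrite e ltn_ord in nlt.
Qed.

(** Resampling one parent keeps the uniform law, because exchanging [x] with [v c] is an involution
    on the pairs [(v, x)]. *)
Lemma Ex_upd f (c : 'I_n) :
  Ex f = Ex (fun v => (\sum_x f (upd v c x)) / n%:R).
Proof.
have n0 : n%:R != 0 :> R by rewrite pnatr_eq0; case: (n) c => [[]|].
rewrite /Ex -mulr_suml; congr (_ / _); apply: (mulIf n0); rewrite mulfVK //.
rewrite (pair_bigA _ (fun v x => f (upd v c x))) /=.
pose h (p : {ffun 'I_n -> 'I_n} * 'I_n) := (upd p.1 c p.2, p.1 c).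
have hK : involutive h.
  move=> [v x]; rewrite /h /= ffunE eqxx; congr (_, _).
  by apply/ffunP => i; rewrite !ffunE; case: eqP => [->|].
rewrite (reindex_inj (inv_inj hK)) /=.
rewrite (eq_bigr (fun p => f p.1)); last first.
  move=> [v x] _ /=; congr f.
  by apply/ffunP => i; rewrite !ffunE; case: eqP => [->|].
rewrite -(pair_bigA _ (fun v _ => f v)) /= mulr_suml; apply: eq_bigr => v _.
by rewrite sumr_const card_ord mulr_natr.
Qed.

Lemma Ex_prod (g : 'I_n -> 'I_n -> R) :
  Ex (fun v => \prod_c g c (v c)) = \prod_c ((\sum_x g c x) / n%:R).
Proof.
rewrite /Ex -bigA_distr_bigA /= big_split /= prodr_const card_ord.
by rewrite natrX -exprVn.
Qed.

Lemma Ex_prod2 (c c' : 'I_n) (g h : 'I_n -> R) : c != c' ->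
  Ex (fun v => g (v c) * h (v c')) =
  (\sum_x g x) / n%:R * ((\sum_x h x) / n%:R).
Proof.
move=> cc'; have n0 : n%:R != 0 :> R by rewrite pnatr_eq0; case: (n) c {cc'} => [[]|].
have c'c : c' != c by rewrite eq_sym.
pose k i x := if i == c then g x else if i == c' then h x else 1.
transitivity (Ex (fun v => \prod_i k i (v i))).
  apply: eq_Ex => v; rewrite (bigD1 c) //= (bigD1 c') //= /k !eqxx (negPf c'c).
  rewrite big1 ?mulr1 // => i /andP[/negPf -> /negPf ->] //.
have kc : \sum_x k c x = \sum_x g x by apply: eq_bigr => x _; rewrite /k eqxx.
have kc' : \sum_x k c' x = \sum_x h x.
  by apply: eq_bigr => x _; rewrite /k eqxx (negPf c'c).
rewrite Ex_prod (bigD1 c) //= kc.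
rewrite [X in _ * X](bigD1 c') //= kc' /k; congr (_ * _); rewrite -[RHS]mulr1; congr (_ * _).
rewrite big1 ?mulr1 // => i /andP[/negPf -> /negPf ->] //.
by rewrite sumr_const card_ord divff.
Qed.

End Expectation.

(** * Bounds at fixed deck size *)

Section FiniteBounds.
Variables (R : realType) (n : nat).
Local Notation Om := {ffun 'I_n -> 'I_n}.
Local Notation E := (@Ex R n).

Lemma highsE (v : Om) m u : highs n (parent v) m u =
  (\sum_(c < n) ((m <= c) && (c < v c <= u)))%N.
Proof.
rewrite /highs -sum1_count -[X in iota 0 X]subn0 -/(index_iota 0 n) big_mkord.
by rewrite big_mkcond; apply: eq_bigr => c _; rewrite parentE; case: ifP.
Qed.

Lemma no_lowE (v : Om) m s : (m <= n)%N -> no_low (parent v) m s =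
  [forall c : 'I_n, (c < m)%N ==> ~~ (c < v c <= s)%N].
Proof.
move=> mn; apply/hasPn/forallP => [h c|h c].
  by apply/implyP => cm; have := h c; rewrite mem_iota parentE => ->.
rewrite mem_iota /= add0n => cm; have cn := leq_trans cm mn.
by have := h (Ordinal cn); rewrite /= cm -(parentE v (Ordinal cn)).
Qed.

Lemma sum_arrival (S : nzRingType) (c : 'I_n) s (a b : S) : (s < n)%N ->
  \sum_(x < n) (if (c < x <= s)%N then a else b) =
  a *+ (s - c) + b *+ (n - (s - c)).
Proof.
move=> sn; rewrite (bigID (fun x : 'I_n => (c < x <= s)%N)) /=.
rewrite (eq_bigr (fun=> a)); last by move=> x ->.
rewrite [X in _ + X](eq_bigr (fun=> b)); last by move=> x /negPf ->.
have card_in : #|[pred x : 'I_n | (c < x <= s)%N]| = (s - c)%N.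
  rewrite -sum1_card (eq_bigl (fun x : 'I_n => (c < x <= s)%N)) //.
  rewrite -(big_mkord (fun x => (c < x <= s)%N) (fun=> 1%N)).
  rewrite -big_filter big_const_seq count_predT iter_addn_0 mul1n.
  have -> : (s - c)%N = size (iota c.+1 (s - c)) by rewrite size_iota.
  apply: perm_size; apply: uniq_perm; rewrite ?filter_uniq ?iota_uniq //.
  by move=> x; rewrite mem_filter mem_index_iota mem_iota; lia.
rewrite !sumr_const card_in; congr (_ + _ *+ _).
rewrite -card_in -[X in (X - _)%N](card_ord n).
rewrite -(cardC [pred x : 'I_n | (c < x <= s)%N]) addKn.
by apply: eq_card => x; rewrite !inE.
Qed.

(** For [s < n], the probability of [c < v c <= s]; truncated subtraction makes it 0 when
    [s <= c]. *)
Definition hit (s c : nat) : R := (s - c)%:R / n%:R.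
Definition no_low_prob (m s : nat) : R := \prod_(c < m) (1 - hit s c).
(** The generating function of the number of high arrivals, a sum of independent Bernoulli
    variables. *)
Definition highs_pgf (m u : nat) : {poly R} :=
  \prod_(m <= c < n) ((1 - hit u c)%:P + (hit u c) *: 'X).
(** For [f] vanishing from [K] on, the mean of [f] at the number of high arrivals by time [u]. *)
Definition highs_mean (K m : nat) (f : nat -> R) (u : nat) : R :=
  \sum_(j < K) (highs_pgf m u)`_j * f j.

(** Low and high arrivals depend on disjoint sets of parents, so the mean factors. Polynomial
    weights give the whole law of the count at once. *)
Lemma Ex_no_low_highs (K m s u : nat) (f : nat -> R) :
  (m <= n)%N -> (s < n)%N -> (u < n)%N -> (forall j, (K <= j)%N -> f j = 0) ->
  E (fun v => (no_low (parent v) m s)%:R * f (highs n (parent v) m u)) =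
  no_low_prob m s * highs_mean K m f u.
Proof.
move=> mn sn un fK; have n0 : n%:R != 0 :> R by rewrite pnatr_eq0; lia.
(* A low card that arrives by [s] kills the product; a high card that arrives by [u] contributes a
   factor ['X]. *)
pose w (c x : 'I_n) : {poly R} :=
  if (c < m)%N then (if (c < x <= s)%N then 0 else 1)
  else if (c < x <= u)%N then 'X else 1.
have gen : \sum_(v : Om) (no_low (parent v) m s)%:R *: 'X^(highs n (parent v) m u) =
    (n ^ n)%:R *: ((no_low_prob m s)%:P * highs_pgf m u).
  transitivity (\sum_(v : Om) \prod_c w c (v c)).
    apply: eq_bigr => v _; rewrite highsE no_lowE //.
    rewrite [RHS](bigID (fun c : 'I_n => (c < m)%N)) /=.
    have -> : \prod_(i < n | (i < m)%N) w i (v i) =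
        ([forall c : 'I_n, (c < m)%N ==> ~~ (c < v c <= s)%N]%:R)%:P.
      case: forallP => [h|/forallP]; first last.
        rewrite negb_forall => /existsP[c]; rewrite negb_imply negbK => /andP[cm cs].
        by rewrite (bigD1 c) //= {1}/w cm cs mul0r.
      rewrite big1 // => c cm; rewrite /w cm.
      by have /implyP/(_ cm)/negPf -> := h c.
    rewrite mul_polyC; congr (_ *: _).
    rewrite (bigID (fun c : 'I_n => (c < m)%N)) /= big1 ?add0n; last first.
      by move=> c cm; rewrite leqNgt cm.
    rewrite -prodrXr; apply: eq_bigr => c /negPf cm; rewrite /w cm leqNgt cm /=.
    by case: ifP.
  rewrite -bigA_distr_bigA /=.
  transitivity (\prod_(c < n) (n%:R *: (if (c < m)%N then (1 - hit s c)%:P else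
      (1 - hit u c)%:P + (hit u c) *: 'X))).
    apply: eq_bigr => c _; rewrite /w /hit; case: (c < m)%N; rewrite sum_arrival //.
      rewrite mul0rn add0r -polyC_natr -mul_polyC -polyCM; congr (_%:P).
      by rewrite mulrBr mulr1 mulrCA divff // mulr1 natrB //; lia.
    rewrite scalerDr scalerA mulrCA divff // mulr1 -mul_polyC -polyCM mulrBr mulr1.
    rewrite mulrCA divff // mulr1 -natrB; last by lia.
    by rewrite addrC polyC_natr scaler_nat.
  rewrite scaler_prod prodr_const card_ord -natrX; congr (_ *: _).
  rewrite /no_low_prob /highs_pgf rmorph_prod /= -(big_mkord xpredT (fun c =>
    if (c < m)%N then (1 - hit s c)%:P else (1 - hit u c)%:P + hit u c *: 'X)).
  rewrite [LHS](big_cat_nat (n := m)) //= big_mkord; congr (_ * _).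
    by apply: eq_bigr => c _; rewrite ltn_ord.
  by apply: eq_big_nat => c /andP[mc _]; rewrite ltnNge mc.
rewrite /Ex; have nn0 : (n ^ n)%:R != 0 :> R by rewrite natrX expf_neq0.
apply: (mulIf nn0); rewrite mulfVK // /highs_mean.
(* The coefficient of ['X^j] collects the parents with exactly [j] high arrivals; counts from [K] on
   are dropped, and there [f] vanishes. *)
transitivity (\sum_(j < K) (\sum_(v : Om) (no_low (parent v) m s)%:R *:
    'X^(highs n (parent v) m u))`_j * f j).
  under [RHS]eq_bigr => j _ do rewrite coef_sum mulr_suml.
  rewrite exchange_big; apply: eq_bigr => v _ /=.
  under eq_bigr => j _ do rewrite coefZ coefXn -mulrA.
  rewrite -mulr_sumr; congr (_ * _).
  have [hK|hK] := ltnP (highs n (parent v) m u) K; last first.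
    rewrite fK // big1 // => j _; case: eqP => [e|_]; last by rewrite mul0r.
    by have := ltn_ord j; rewrite e ltnNge hK.
  rewrite (bigD1 (Ordinal hK)) //= eqxx mul1r big1 ?addr0 // => j /eqP jh.
  by case: eqP => [e|]; [case: jh; apply: val_inj|rewrite mul0r].
rewrite gen mulr_sumr mulr_suml; apply: eq_bigr => j _.
by rewrite coefZ coefCM; ring.
Qed.

Lemma no_low0 (a : nat -> nat) m : no_low a m 0.
Proof. by apply/hasPn => c _; apply/negP; lia. Qed.

Lemma no_low_prob0 m : no_low_prob m 0 = 1.
Proof. by rewrite /no_low_prob big1 // => c _; rewrite /hit sub0n mul0r subr0. Qed.

Lemma Ex_highs (K m u : nat) (f : nat -> R) :
  (m <= n)%N -> (u < n)%N -> (forall j, (K <= j)%N -> f j = 0) ->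
  E (fun v => f (highs n (parent v) m u)) = highs_mean K m f u.
Proof.
move=> mn un fK; have n0 : (0 < n)%N by lia.
rewrite -[RHS]mul1r -(no_low_prob0 m) -Ex_no_low_highs //.
by apply: eq_Ex => v; rewrite no_low0 mul1r.
Qed.

Lemma Ex_no_low m s : (m <= n)%N -> (s < n)%N ->
  E (fun v => (no_low (parent v) m s)%:R) = no_low_prob m s.
Proof.
move=> mn sn; have n0 : (0 < n)%N by lia.
(* The indicator of [j <= n] meets the support condition and is 1 at every possible count. *)
have := @Ex_no_low_highs n.+1 m s s (fun j => (j <= n)%N%:R) mn sn sn.
rewrite -Ex_highs // => [h|j]; last by rewrite ltnNge => /negPf ->.
have le1 (v : Om) : (highs n (parent v) m s <= n)%N.
  by rewrite (leq_trans (count_size _ _)) // size_iota.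
move: h; rewrite (eq_Ex (g := fun v => (no_low (parent v) m s)%:R)); last first.
  by move=> v; rewrite le1 mulr1.
rewrite (@eq_Ex R n (fun v => (highs n (parent v) m s <= n)%N%:R) (fun=> 1)); last first.
  by move=> v; rewrite le1.
by rewrite Ex_cst // mulr1 => -> // j; rewrite ltnNge => /negPf ->.
Qed.

(** * Probability that the parents are not good *)

Definition goodb (T : nat) (a : nat -> nat) : bool :=
  all (fun c => ~~ [&& a c < c, a c < a (a c) & a (a c) <= T])%N (iota 0 T).

Lemma goodbP T a : goodb T a -> good a T.
Proof.
move=> /allP h c' c /andP[c'c cT] e; have := h c.
by rewrite mem_iota e /= add0n c'c /= => /(_ cT).
Qed.

(** Union bound over the pairs [c' < c < T]: the events [v c = c'] and [c' < v c' <= T] are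
    independent, of probabilities [1/n] and at most [T/n], and there are at most [T^2] pairs. *)
Lemma Ex_bad T : (T < n)%N ->
  E (fun v => (~~ goodb T (parent v))%:R) <= T%:R ^+ 3 / n%:R ^+ 2.
Proof.
move=> Tn; have n0 : (0 < n)%N by lia.
have n0' : 0 < n%:R :> R by rewrite ltr0n.
pose g (c x : 'I_n) : R := (x == c)%:R.
pose h (c x : 'I_n) : R := if (c < x <= T)%N then 1 else 0.
apply: (@le_trans _ _ (\sum_(c < n | (c < T)%N) \sum_(c' < n | (c' < c)%N)
   E (fun v => g c' (v c) * h c' (v c')))).
  under eq_bigr => c _ do rewrite -Ex_sum.
  rewrite -Ex_sum; apply: le_Ex => v.
  have pos (c c' : 'I_n) : 0 <= g c' (v c) * h c' (v c').
    by rewrite mulr_ge0 ?ler0n // /h; case: ifP.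
  case: (boolP (goodb T (parent v))) => [_|];
    first by rewrite /= sumr_ge0 // => c _; rewrite sumr_ge0.
  rewrite /goodb -has_predC => /hasP[c]; rewrite mem_iota /= negbK => cT.
  have cn : (c < n)%N by lia.
  rewrite -[c]/(Ordinal cn : nat) !parentE => /and3P[vc vvc vT].
  rewrite (bigD1 (Ordinal cn)) //= (bigD1 (v (Ordinal cn))) //=.
  have -> : g (v (Ordinal cn)) (v (Ordinal cn)) *
      h (v (Ordinal cn)) (v (v (Ordinal cn))) = 1.
    by rewrite /g eqxx /h vvc vT mul1r.
  rewrite -addrA lerDl addr_ge0 //; first by apply: sumr_ge0 => i _; apply: pos.
  by apply: sumr_ge0 => i _; apply: sumr_ge0 => j _; apply: pos.
have bnd (c c' : 'I_n) : (c' < c)%N ->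
    E (fun v => g c' (v c) * h c' (v c')) <= T%:R / n%:R ^+ 2.
  move=> c'c; rewrite Ex_prod2; last by apply/negP => /eqP e; rewrite e ltnn in c'c.
  rewrite sum_arrival // mul0rn addr0.
  rewrite (_ : \sum_x g c' x = 1); last first.
    by rewrite (bigD1 c') //= /g eqxx big1 ?addr0 // => x /negPf ->.
  rewrite mul1r expr2 invfM [leRHS]mulrCA ler_wpM2l ?invr_ge0 ?(ltW n0') //.
  by rewrite ler_wpM2r ?invr_ge0 ?(ltW n0') // ler_nat leq_subr.
have cnt k : (k <= n)%N -> \sum_(c < n | (c < k)%N) (1 : R) = k%:R.
  by move=> kn; rewrite -(big_ord_widen n (fun=> 1)) // sumr_const card_ord.
apply: (@le_trans _ _ (\sum_(c < n | (c < T)%N) T%:R * (T%:R / n%:R ^+ 2))).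
  apply: ler_sum => c cT; apply: (le_trans (ler_sum _ (fun c' h => bnd c c' h))).
  rewrite -[X in \sum_(_ < _ | _) X]mul1r -mulr_suml cnt 1?ltnW // ler_wpM2r //.
    by rewrite divr_ge0 // exprn_ge0 // ltW.
  by rewrite ler_nat ltnW.
by rewrite -[X in \sum_(_ < _ | _) X]mul1r -mulr_suml cnt ?(ltnW Tn) // !mulrA -expr2 -exprSr.
Qed.

(* The probability that the first low card, with [j] cards in front of it, ends
   up with fewer than [K] cards in front of it after [s] more steps. *)
Fixpoint stay (K s j : nat) : R :=
  if s is s'.+1 then
    (1 - j.+1%:R / n%:R) * stay K s' j + j.+1%:R / n%:R * stay K s' j.+1
  else (j < K)%N%:R.

Lemma stay_out K s j : (K <= j)%N -> stay K s j = 0.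
Proof.
elim: s j => [|s IH] j Kj /=; first by rewrite ltnNge Kj.
by rewrite !IH ?mulr0 ?addr0 // ltnW.
Qed.

Lemma stay_ge0 K s j : (K <= n)%N -> 0 <= stay K s j.
Proof.
move=> Kn; elim: s j => [|s IH] j /=; first exact: ler0n.
(* The weight [j.+1/n] can exceed 1 only for [j >= n >= K], where [stay] is 0. *)
have [Kj|jK] := leqP K j; first by rewrite !stay_out ?mulr0 ?addr0 // ltnW.
have n0 : 0 < n%:R :> R by rewrite ltr0n; lia.
rewrite addr_ge0 // mulr_ge0 ?IH // ?divr_ge0 ?ler0n // subr_ge0.
by rewrite ler_pdivrMr // mul1r ler_nat; lia.
Qed.

(** Coupling of the chains started at [j] and [j.+1]: below [K], the difference after one step
    combines the next differences with nonnegative weights. *)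
Lemma stayS_le K s j : (K <= n)%N -> stay K s j.+1 <= stay K s j.
Proof.
move=> Kn; elim: s j => [|s IH] j /=; first by rewrite ler_nat; lia.
have [Kj|jK] := leqP K j.
  by rewrite !stay_out ?mulr0 ?addr0 //; lia.
have n0 : 0 < n%:R :> R by rewrite ltr0n; lia.
set A := stay K s j; set B := stay K s j.+1; set C := stay K s j.+2.
have AB : 0 <= A - B by rewrite subr_ge0 IH.
have BC : 0 <= B - C by rewrite subr_ge0 IH.
rewrite -subr_ge0.
have -> : (1 - j.+1%:R / n%:R) * A + j.+1%:R / n%:R * B -
   ((1 - j.+2%:R / n%:R) * B + j.+2%:R / n%:R * C) =
   (1 - j.+1%:R / n%:R) * (A - B) + j.+2%:R / n%:R * (B - C) by ring.
rewrite addr_ge0 // mulr_ge0 // ?divr_ge0 ?ler0n // subr_ge0.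
by rewrite ler_pdivrMr // mul1r ler_nat; lia.
Qed.

Lemma stay_le K s i j : (K <= n)%N -> (i <= j)%N -> stay K s j <= stay K s i.
Proof.
move=> Kn; elim: j => [|j IH]; first by rewrite leqn0 => /eqP ->.
rewrite leq_eqVlt => /predU1P[->//|ij]; exact: le_trans (stayS_le _ _ Kn) (IH ij).
Qed.

Lemma stay_le1 K s j : (K <= n)%N -> stay K s j <= 1.
Proof.
move=> Kn; elim: s j => [|s IH] j /=; first by case: (j < K)%N.
have [Kj|jK] := leqP K j; first by rewrite !stay_out ?mulr0 ?addr0 //; lia.
have n0 : 0 < n%:R :> R by rewrite ltr0n; lia.
have p1 : j.+1%:R / n%:R <= 1 :> R by rewrite ler_pdivrMr // mul1r ler_nat; lia.
have p0 : 0 <= j.+1%:R / n%:R :> R by rewrite divr_ge0 ?ler0n.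
have := IH j; have := IH j.+1; nra.
Qed.

(* [j.+1] grows in mean by the factor [1 + 1/n] per step: Markov's inequality. *)
Lemma stay_markov K s j : (K <= n)%N -> (0 < n)%N ->
  1 - stay K s j <= j.+1%:R * (1 + n%:R^-1) ^+ s / K.+1%:R.
Proof.
move=> Kn n0; have n0' : 0 < n%:R^-1 :> R by rewrite invr_gt0 ltr0n.
elim: s j => [|s IH] j.
  rewrite /= expr0 mulr1 ler_pdivlMr ?ltr0n //; case: ltnP => h.
    by rewrite subrr mul0r ler0n.
  by rewrite subr0 mul1r ler_nat.
have [Kj|jK] := leqP K j.
  rewrite stay_out // subr0 ler_pdivlMr ?ltr0n // mul1r.
  have h1 : 1 <= (1 + n%:R^-1) ^+ s.+1 :> R by rewrite exprn_ege1 // lerDl ltW.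
  have h2 : K.+1%:R <= j.+1%:R :> R by rewrite ler_nat.
  by rewrite (le_trans h2) // ler_peMr.
have p1 : 0 <= 1 - j.+1%:R / n%:R :> R.
  by rewrite subr_ge0 ler_pdivrMr ?ltr0n // mul1r ler_nat; lia.
have p0 : 0 <= j.+1%:R / n%:R :> R by rewrite divr_ge0 ?ler0n.
have := ler_wpM2l p1 (IH j); have := ler_wpM2l p0 (IH j.+1) => a b /=.
have := lerD b a; rewrite exprS; set p := _ / _ in p0 p1 a b *.
set q := n%:R^-1; have pq : p = j.+1%:R * q by [].
set S := (1 + q) ^+ s; rewrite -[j.+2%:R]natr1; set J := j.+1%:R in pq *.
have -> : J * ((1 + q) * S) / K.+1%:R =
  (1 - p) * (J * S / K.+1%:R) + p * ((J + 1) * S / K.+1%:R) by rewrite pq; ring.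
by apply: le_trans; rewrite le_eqVlt; apply/orP; left; apply/eqP; ring.
Qed.

(** * The first low card as a Markov chain after time [T] *)

Definition caught (T m : nat) (v : Om) : bool :=
  goodb T (parent v) && ~~ no_low (parent v) m T.

(** The event only looks at parents of cards below [T]: [goodb] uses [a c] for [c < T] and [a (a c)]
    when [a c < c], and [no_low] uses cards below [m <= T]. *)
Lemma caught_upd (T m : nat) (v : Om) (c x : 'I_n) : (m <= T <= c)%N ->
  caught T m (upd v c x) = caught T m v.
Proof.
move=> /andP[mT Tc].
have pE i : (i < T)%N -> parent (upd v c x) i = parent v i.
  by move=> iT; rewrite parent_upd ifN //; apply/negP => /eqP; lia.
rewrite /caught /goodb /no_low; congr (_ && ~~ ~~ _).
  apply: eq_in_all => i; rewrite mem_iota /= => iT; rewrite pE //.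
  by case: (ltnP (parent v i) i) => //= vi; rewrite pE // (ltn_trans vi).
by apply: eq_in_has => i; rewrite mem_iota /= => im; rewrite pE //; lia.
Qed.

Lemma sum_index_rem (v : Om) t (f : nat -> R) : (t < n)%N ->
  \sum_(x < n) f (index (x : nat) (rem t (deck_at n (parent v) t))) = \sum_(i < n) f i.
Proof.
move=> tn; set r := rem _ _.
have lt x : (index x r < n)%N.
  by rewrite (leq_ltn_trans (index_size _ _)) // size_rem_deck_at //; lia.
pose h (x : 'I_n) := Ordinal (lt x).
have h_inj : injective h.
  move=> x y /(congr1 val) /= e; apply: val_inj => /=.
  exact: (index_rem_deck_at_inj tn _ _ e).
by rewrite [RHS](reindex_inj h_inj).
Qed.

(** Resampling the parent of [t] makes its slot uniform on [n] values, while [caught] and the deck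
    at time [t] stay fixed. Exactly [J.+1] slots push the first low card back, which is the
    recursion of [stay]. *)
Lemma Ex_caught_step K (T m t : nat) : (m <= T <= t)%N -> (t < n)%N ->
  E (fun v => (caught T m v)%:R * stay K (n - t) (first_low n (parent v) m t)) =
  E (fun v => (caught T m v)%:R * stay K (n - t.+1) (first_low n (parent v) m t.+1)).
Proof.
move=> /andP[mT Tt] tn; have n0 : n%:R != 0 :> R by rewrite pnatr_eq0; lia.
rewrite [RHS](Ex_upd _ (Ordinal tn)); apply: eq_Ex => v.
under eq_bigr => x _ do rewrite caught_upd ?mT //.
rewrite -mulr_sumr -mulrA; case C : (caught T m v); last by rewrite !mul0r.
congr (_ * _); set J := first_low n (parent v) m t.
have [gT nl] := andP C.
have lt u : (t <= u < n)%N -> (J < index u (deck_at n (parent v) t))%N.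
  by apply: (@first_low_unmoved _ _ _ T) => //; [exact: parent_lt|exact: goodbP|lia].
have Jn : (J.+1 < n)%N.
  have := lt t; rewrite leqnn tn => /(_ isT) h.
  have := @index_deck_at_lt n (parent v) t t (ltnW tn); lia.
have dE x : deck_at n (parent (upd v (Ordinal tn) x)) t = deck_at n (parent v) t.
  by apply: eq_deck_at => s st; rewrite parent_upd ifN //; apply/negP => /eqP /=; lia.
have JE x : first_low n (parent (upd v (Ordinal tn) x)) m t.+1 =
    (J + (index (x : nat) (rem t (deck_at n (parent v) t)) <= J))%N.
  rewrite first_low_step //; [|lia|]; rewrite /first_low dE.
    by rewrite parent_upd eqxx.
  by apply: lt; rewrite leqnn.
under eq_bigr => x _ do rewrite JE.
rewrite (sum_index_rem v (fun i => stay K (n - t.+1) (J + (i <= J))%N)) //.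
rewrite -(big_mkord xpredT (fun i => stay K (n - t.+1) (J + (i <= J))%N)).
rewrite (big_cat_nat (n := J.+1)) //=; last by lia.
rewrite (eq_big_nat _ _ (F2 := fun=> stay K (n - t.+1) J.+1)); last first.
  by move=> i /andP[_ iJ]; rewrite -ltnS iJ addn1.
rewrite [X in _ + X](eq_big_nat _ _ (F2 := fun=> stay K (n - t.+1) J)); last first.
  by move=> i /andP[Ji _]; rewrite leqNgt Ji addn0.
rewrite !sumr_const_nat subn0 -[_ *+ J.+1]mulr_natr -[_ *+ (n - J.+1)]mulr_natr.
rewrite natrB; last by lia.
have -> : (n - t)%N = (n - t.+1).+1 by lia.
by rewrite /=; field.
Qed.

Lemma Ex_caught K (T m : nat) : (m <= T)%N -> (T < n)%N ->
  E (fun v => (caught T m v)%:R * stay K (n - T) (first_low n (parent v) m T)) =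
  E (fun v => (caught T m v)%:R * (first_low n (parent v) m n < K)%N%:R).
Proof.
move=> mT Tn.
suff H d : (T + d <= n)%N ->
  E (fun v => (caught T m v)%:R * stay K (n - T) (first_low n (parent v) m T)) =
  E (fun v => (caught T m v)%:R * stay K (n - (T + d)) (first_low n (parent v) m (T + d))).
  rewrite (H (n - T)%N); last by lia.
  by have -> : (T + (n - T) = n)%N by [lia]; rewrite subnn.
elim: d => [|d IH] h; first by rewrite addn0.
rewrite IH; last by lia.
by rewrite addnS Ex_caught_step //; lia.
Qed.

Lemma hit_ge0 s c : 0 <= hit s c. Proof. by rewrite divr_ge0 ?ler0n. Qed.

Lemma hit_le1 s c : (s < n)%N -> hit s c <= 1.
Proof. by move=> sn; rewrite ler_pdivrMr ?ltr0n ?mul1r ?ler_nat; lia. Qed.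

Lemma no_low_prob_ge0 m s : (s < n)%N -> 0 <= no_low_prob m s.
Proof. by move=> sn; apply: prodr_ge0 => c _; rewrite subr_ge0 hit_le1. Qed.

(** For products of factors in [0, 1], the difference is at most the sum of the differences of the
    factors. *)
Lemma no_low_prob_sub m s u : (s <= u < n)%N ->
  no_low_prob m s - no_low_prob m u <= m%:R * (u - s)%:R / n%:R.
Proof.
move=> /andP[su un]; rewrite /no_low_prob; elim: m => [|k IH].
  by rewrite !big_ord0 subrr !mul0r.
rewrite !big_ord_recr /=; set A := \prod_(i < k) _ in IH *; set B := \prod_(i < k) _ in IH *.
have A1 : 0 <= B <= 1.
  apply/andP; split; first by apply: prodr_ge0 => c _; rewrite subr_ge0 hit_le1.
  apply: prodr_ile1 => c _; rewrite subr_ge0 hit_le1 // gerBl hit_ge0 //.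
have hs1 := hit_le1 k (leq_ltn_trans su un); have hs0 := hit_ge0 s k.
have d : hit u k - hit s k <= (u - s)%:R / n%:R.
  by rewrite -mulrBl ler_wpM2r ?invr_ge0 ?ler0n // lerBlDr -natrD ler_nat; lia.
have d0 : 0 <= hit u k - hit s k.
  by rewrite -mulrBl mulr_ge0 ?invr_ge0 ?ler0n // subr_ge0 ler_nat; lia.
rewrite -natr1 mulrDl mul1r mulrDl.
have k0 : 0 <= k%:R * (u - s)%:R / n%:R :> R by rewrite divr_ge0 ?mulr_ge0 ?ler0n.
nra.
Qed.

(** * Bounds from a grid of times *)

Section Sandwich.
Variables (K m T N : nat) (t : nat -> nat).
Hypotheses (Kn : (K <= n)%N) (mT : (m <= T)%N) (Tn : (T < n)%N).
Hypotheses (t0 : t 0%N = 0%N) (tN : t N = T) (tS : forall i, (t i <= t i.+1)%N).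
Let w := stay K (n - T).
Let P := E (fun v => (first_low n (parent v) m n < K)%N%:R).
Let G i := no_low_prob m (t i).
Let psi i := highs_mean K m w (t i).
Let nl (v : Om) i : R := (no_low (parent v) m (t i))%:R.

Lemma grid_le i j : (i <= j)%N -> (t i <= t j)%N.
Proof. exact: (homo_leq leqnn leq_trans tS). Qed.

(** A low arrival stays counted at later times, so this difference is the indicator that the first
    low arrival falls in block [i]. *)
Lemma nl_decr v i : 0 <= nl v i - nl v i.+1.
Proof.
rewrite subr_ge0 ler_nat /no_low; case: hasPn => // h; case: hasPn => // -[] c /h.
by have := tS i; lia.
Qed.

Lemma sum_nl v : \sum_(i < N) (nl v i - nl v i.+1) = 1 - nl v N.
Proof.
rewrite -(big_mkord xpredT (fun i => nl v i - nl v i.+1)).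
rewrite -[LHS]opprK -sumrN (eq_bigr (fun i => nl v i.+1 - nl v i)).
  by rewrite telescope_sumr // opprB {1}/nl t0 no_low0.
by move=> i _; rewrite opprB.
Qed.

Lemma Ex_grid (s : nat -> nat) : (forall i, (i < N)%N -> (s i <= N)%N) ->
  E (fun v => \sum_(i < N) (nl v i - nl v i.+1) * w (highs n (parent v) m (t (s i)))) =
  \sum_(i < N) (G i - G i.+1) * psi (s i).
Proof.
move=> sN; rewrite Ex_sum; apply: eq_bigr => i _.
have tn j : (j <= N)%N -> (t j < n)%N.
  by move=> jN; rewrite (leq_ltn_trans (grid_le jN)) ?tN.
have wK j : (K <= j)%N -> w j = 0 by exact: stay_out.
have mn : (m <= n)%N by lia.
have iN := ltn_ord i.
rewrite (eq_Ex (g := fun v => nl v i * w (highs n (parent v) m (t (s i))) -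
   nl v i.+1 * w (highs n (parent v) m (t (s i))))); last by move=> v; rewrite mulrBl.
rewrite ExB /nl !(@Ex_no_low_highs K) ?mulrBl // tn ?sN //; exact: ltnW.
Qed.

(** If the first low arrival falls in block [i], then [first_low] at time [T] is at most the number
    of high arrivals by the end of the block. As [stay] decreases in its start, this bounds [stay]
    at time [T] from below, and [Ex_caught] carries it to the event at time [n]. *)
Lemma sandwich_lower :
  \sum_(i < N) (G i - G i.+1) * psi i.+1 - T%:R ^+ 3 / n%:R ^+ 2 <= P.
Proof.
apply: (@le_trans _ _ (\sum_(i < N) (G i - G i.+1) * psi i.+1 -
    E (fun v => (~~ goodb T (parent v))%:R))); first by rewrite lerD2l lerN2 Ex_bad.
rewrite -(@Ex_grid succn) // -ExB.
apply: (@le_trans _ _ (E (fun v => (caught T m v)%:R * (first_low n (parent v) m n < K)%N%:R))).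
  rewrite -Ex_caught //; apply: le_Ex => v; rewrite -/w.
  (* Off the good event the subtracted indicator is 1, and it dominates the sum because the block
     indicators add up to at most 1. *)
  case g : (goodb T (parent v)); last first.
    rewrite /caught g mul0r subr_le0 (@le_trans _ _ (\sum_(i < N) (nl v i - nl v i.+1))) //.
      by apply: ler_sum => i _; rewrite ler_piMr ?nl_decr // stay_le1.
    by rewrite sum_nl gerBl ler0n.
  rewrite /= subr0.
  have -> : (caught T m v)%:R = \sum_(i < N) (nl v i - nl v i.+1).
    by rewrite sum_nl /caught g /nl tN; case: no_low; rewrite /= ?subr0 ?subrr.
  rewrite mulr_suml; apply: ler_sum => i _.
  case h : (no_low (parent v) m (t i.+1)).
    have := nl_decr v i; rewrite /nl h; case: no_low => /=; first by rewrite subrr !mul0r.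
    by rewrite sub0r oppr_ge0 => /(lt_le_trans ltr01); rewrite ltxx.
  rewrite ler_wpM2l ?nl_decr // stay_le // (@first_low_le _ _ (parent_lt v) T) ?h //.
  - exact: goodbP.
  - lia.
  - by rewrite -tN grid_le.
by apply: le_Ex => v; rewrite ler_piMl ?ler0n //; case: caught.
Qed.

(** Now the high arrivals by the start of the block are used. The event may also occur with no low
    arrival by [T], whence [G N], or off the good event. *)
Lemma sandwich_upper :
  P <= \sum_(i < N) (G i - G i.+1) * psi i + G N + T%:R ^+ 3 / n%:R ^+ 2.
Proof.
apply: (@le_trans _ _ (\sum_(i < N) (G i - G i.+1) * psi i + G N +
    E (fun v => (~~ goodb T (parent v))%:R))); last by rewrite lerD2l Ex_bad.
rewrite -(@Ex_grid id) //; last by move=> i /ltnW.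
rewrite /G -Ex_no_low ?tN //; last by lia.
apply: (@le_trans _ _ (E (fun v =>
   (caught T m v)%:R * (first_low n (parent v) m n < K)%N%:R +
   (no_low (parent v) m T)%:R + (~~ goodb T (parent v))%:R))).
  apply: le_Ex => v; rewrite /caught.
  case: (goodb T _); case: (no_low _ _ T); case: (_ < K)%N => /=; lra.
rewrite !ExD !lerD2r -Ex_caught //; apply: le_Ex => v.
have pos i : 0 <= (nl v i - nl v i.+1) * w (highs n (parent v) m (t i)).
  by rewrite mulr_ge0 ?nl_decr ?stay_ge0.
case C : (caught T m v); last by rewrite mul0r sumr_ge0.
have [g h] := andP C.
have -> : true%:R = \sum_(i < N) (nl v i - nl v i.+1).
  by rewrite sum_nl /nl tN (negPf h) subr0.
rewrite mulr_suml; apply: ler_sum => i _.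
case k : (no_low (parent v) m (t i)).
  rewrite ler_wpM2l ?nl_decr // stay_le // (@first_low_ge _ _ (parent_lt v) T) //.
  - exact: goodbP.
  - lia.
  - by rewrite -tN grid_le // ltnW.
have := nl_decr v i; rewrite /nl k; case: no_low => /=; last by rewrite subrr !mul0r.
by rewrite sub0r oppr_ge0 => /(lt_le_trans ltr01); rewrite ltxx.
Qed.

Lemma highs_mean_decr i : (i < N)%N -> psi i.+1 <= psi i.
Proof.
move=> iN; have tn j : (j <= N)%N -> (t j < n)%N.
  by move=> jN; rewrite (leq_ltn_trans (grid_le jN)) ?tN.
have wK j : (K <= j)%N -> w j = 0 by exact: stay_out.
have mn : (m <= n)%N by lia.
rewrite /psi -!Ex_highs // ?tn //; last exact: ltnW.
apply: le_Ex => v; apply: stay_le => //; apply: sub_count => c /=.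
by have := tS i; lia.
Qed.

(** Each block has weight at most [m d / n] by [no_low_prob_sub], and the differences of [psi]
    telescope to at most 1. *)
Lemma sandwich_gap (d : nat) : (forall i, (i < N)%N -> (t i.+1 - t i <= d)%N) ->
  \sum_(i < N) (G i - G i.+1) * psi i <=
  \sum_(i < N) (G i - G i.+1) * psi i.+1 + m%:R * d%:R / n%:R.
Proof.
move=> td; rewrite -lerBlDl -sumrB.
have tn j : (j <= N)%N -> (t j < n)%N.
  by move=> jN; rewrite (leq_ltn_trans (grid_le jN)) ?tN.
have mn : (m <= n)%N by lia.
have wK j : (K <= j)%N -> w j = 0 by exact: stay_out.
have psi1 : psi 0 <= 1.
  rewrite /psi -Ex_highs // ?tn // -[leRHS](@Ex_cst R n); last by lia.
  by apply: le_Ex => v; rewrite stay_le1.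
have psi0 : 0 <= psi N.
  rewrite /psi -Ex_highs // ?tn // -[leLHS](@Ex_cst R n); last by lia.
  by apply: le_Ex => v; rewrite stay_ge0.
have D0 : 0 <= m%:R * d%:R / n%:R :> R by rewrite divr_ge0 ?mulr_ge0 ?ler0n.
apply: (@le_trans _ _ (\sum_(i < N) m%:R * d%:R / n%:R * (psi i - psi i.+1))).
  apply: ler_sum => i _; rewrite -mulrBr ler_wpM2r ?subr_ge0 ?highs_mean_decr //.
  apply: le_trans (no_low_prob_sub _ _) _; first by rewrite tS tn.
  by rewrite ler_wpM2r ?invr_ge0 ?ler0n // ler_wpM2l ?ler0n // ler_nat td.
rewrite -mulr_sumr -[leRHS]mulr1 ler_wpM2l //.
rewrite -(big_mkord xpredT (fun i => psi i - psi i.+1)).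
rewrite -[leLHS]opprK -sumrN (eq_bigr (fun i => psi i.+1 - psi i)).
  by rewrite telescope_sumr // opprB; lra.
by move=> i _; rewrite opprB.
Qed.

End Sandwich.
End FiniteBounds.

(** * Limits *)

Section Limits.
Variable R : realType.
Implicit Types (p e : nat -> R) (r : seq nat).

(** For [0 <= x <= e < 1] one has [exp(-x/(1-e)) <= 1 - x <= exp(-x)], and the resulting bounds on
    the product merge as [e] tends to 0. *)
Lemma cvg_prod_1sub (r : nat -> seq nat) (p : nat -> nat -> R) e lam :
  (forall n c, 0 <= p n c <= e n) -> e n @[n --> \oo] --> 0 ->
  \sum_(c <- r n) p n c @[n --> \oo] --> lam ->
  \prod_(c <- r n) (1 - p n c) @[n --> \oo] --> expR (- lam).
Proof.
move=> pe e0 plam.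
have e1 : \forall n \near \oo, e n < 1 by exact: (cvgr_lt 0).
have c1 : 1 - e n @[n --> \oo] --> (1 : R).
  by rewrite -[X in _ --> X]subr0; apply: cvgB => //; exact: cvg_cst.
apply: (@squeeze_cvgr _ _ _ _ (fun n => expR (- (\sum_(c <- r n) p n c / (1 - e n))))
  (fun n => expR (- \sum_(c <- r n) p n c))).
- near=> n; have en : e n < 1 by near: n.
  have d0 : 0 < 1 - e n by rewrite subr_gt0.
  rewrite -!sumrN !expR_sum; apply/andP; split; apply: ler_prod => c _.
    have /andP[p0 pE] := pe n c.
    rewrite expR_ge0 /= expRN; set q := p n c / _.
    rewrite -[X in X <= _]mul1r ler_pdivrMr ?expR_gt0 //.
    have q1 : (1 - p n c) * (1 + q) >= 1.
      have -> : (1 - p n c) * (1 + q) = 1 + p n c * (e n - p n c) / (1 - e n).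
        by rewrite /q; field; rewrite gt_eqF.
      by rewrite lerDl divr_ge0 ?mulr_ge0 ?subr_ge0 // ltW.
    apply: le_trans q1 _; rewrite ler_wpM2l ?expR_ge1Dx // subr_ge0.
    exact: le_trans pE (ltW en).
  have /andP[p0 pE] := pe n c.
  rewrite subr_ge0 (le_trans pE (ltW en)) /=.
  exact: expR_ge1Dx.
- apply: (@cvg_comp _ _ _ _ expR) => /=; last exact: continuous_expR.
  apply: cvgN; rewrite -[X in _ --> X]divr1.
  under eq_fun do rewrite -mulr_suml.
  by apply: cvgM => //; apply: cvgV => //; exact: oner_neq0.
- apply: (@cvg_comp _ _ _ _ expR) => /=; last exact: continuous_expR.
  exact: cvgN.
Unshelve. all: by end_near.
Qed.

Definition pgf r p : {poly R} := \prod_(c <- r) ((1 - p c)%:P + p c *: 'X).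

(** The [j]-th coefficient of ['X * f]. *)
Let coefp1 (f : {poly R}) j : R := if j is i.+1 then f`_i else 0.

Lemma coef_pgf_cons c r p j : (pgf (c :: r) p)`_j =
  (1 - p c) * (pgf r p)`_j + p c * coefp1 (pgf r p) j.
Proof.
rewrite /pgf big_cons mulrDl coefD coefCM -scalerAl coefZ coefXM.
by case: j.
Qed.

Lemma coef_pgf_itv r p j : (forall c, 0 <= p c <= 1) -> 0 <= (pgf r p)`_j <= 1.
Proof.
move=> p01; elim: r j => [|c r IH] j.
  by rewrite /pgf big_nil coef1; case: (j == 0%N); rewrite ?ler01 ?lexx.
have /andP[p0 p1] := p01 c; have /andP[f0 f1] := IH j.
have /andP[g0 g1] : 0 <= coefp1 (pgf r p) j <= 1.
  by case: j {f0 f1} => [|i]; rewrite /= ?lexx ?ler01.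
rewrite coef_pgf_cons; apply/andP; split; nra.
Qed.

(* The recursion [j a_j = lambda a_(j-1)] of the Poisson weights, with an
   error term. *)
Lemma coef_pgf_rec r p j : (forall c, 0 <= p c <= 1) ->
  `|j%:R * (pgf r p)`_j - (\sum_(c <- r) p c) * coefp1 (pgf r p) j|
    <= \sum_(c <- r) p c ^+ 2.
Proof.
move=> p01; elim: r j => [|c r IH] j.
  rewrite !big_nil mul0r subr0 /pgf big_nil coef1.
  by case: j => [|j]; rewrite /= ?mul0r ?mulr0 normr0.
case: j => [|j].
  by rewrite mul0r mulr0 subr0 normr0 sumr_ge0 // => i _; rewrite sqr_ge0.
have /andP[p0 p1] := p01 c; have := IH j; have := IH j.+1.
have := coef_pgf_itv r j p01.
have : 0 <= coefp1 (pgf r p) j <= 1.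
  by case: j => [|i]; rewrite /= ?lexx ?ler01 ?coef_pgf_itv.
rewrite !big_cons /= !coef_pgf_cons /=.
set f0 := coefp1 _ _; set f1 := (pgf r p)`_j; set f2 := (pgf r p)`_j.+1.
set S := \sum_(i <- r) _; set V := \sum_(i <- r) _; set q := p c in p0 p1 *.
move=> /andP[f00 f01] /andP[f10 f11] h2 h1.
have -> : j.+1%:R * ((1 - q) * f2 + q * f1) - (q + S) * ((1 - q) * f1 + q * f0) =
  (1 - q) * (j.+1%:R * f2 - S * f1) + q * (j%:R * f1 - S * f0) + q ^+ 2 * (f1 - f0).
  by rewrite -natr1; ring.
apply: (le_trans (ler_normD _ _)); rewrite [leRHS]addrC; apply: lerD.
  apply: (le_trans (ler_normD _ _)); rewrite !normrM ger0_norm ?subr_ge0 // (ger0_norm p0).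
  nra.
rewrite normrM ger0_norm ?sqr_ge0 // ler_piMr ?sqr_ge0 // ler_norml; lra.
Qed.

(** The constant coefficient is the product of the [1 - p n c], and the Poisson recursion passes
    convergence from [j] to [j.+1], its error being at most [e n] times the sum of the [p n c]. *)
Lemma cvg_coef_pgf (r : nat -> seq nat) (p : nat -> nat -> R) e (lam : R) j :
  (forall n c, 0 <= p n c <= e n) -> e n @[n --> \oo] --> 0 ->
  \sum_(c <- r n) p n c @[n --> \oo] --> lam ->
  exists a : R, ((pgf (r n) (p n))`_j : R) @[n --> \oo] --> a.
Proof.
move=> pe e0 plam.
have e1 : \forall n \near \oo, e n < 1 by exact: (cvgr_lt 0).
elim: j => [|j [a fa]].
  exists (expR (- lam)).
  rewrite (_ : (fun n => _) = (fun n => \prod_(c <- r n) (1 - p n c))).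
    exact: (cvg_prod_1sub pe).
  apply/funext => n; rewrite -horner_coef0 /pgf horner_prod.
  by apply: eq_bigr => c _; rewrite !hornerE ?mulr0 ?addr0.
pose S n := \sum_(c <- r n) p n c; pose F n := pgf (r n) (p n).
pose d n := j.+1%:R * (F n)`_j.+1 - S n * (F n)`_j.
have d0 : d n @[n --> \oo] --> 0.
  have eS : e n * S n @[n --> \oo] --> 0 * lam by exact: cvgM.
  rewrite mul0r in eS.
  apply: (@squeeze_cvgr _ _ _ _ (fun n => - (e n * S n)) (fun n => e n * S n)) => //.
    near=> n; have en : e n < 1 by near: n.
    rewrite -ler_norml; have p01 c : 0 <= p n c <= 1.
      by have /andP[-> /= h] := pe n c; rewrite (le_trans h) // ltW.
    apply: le_trans (coef_pgf_rec (r n) j.+1 p01) _; rewrite /S mulr_sumr.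
    apply: ler_sum => c _; have /andP[h0 h] := pe n c.
    by rewrite expr2 ler_wpM2r.
  by rewrite -oppr0; apply: cvgN.
exists ((0 + lam * a) / j.+1%:R).
rewrite (_ : (fun n => _) = (fun n => (d n + S n * (F n)`_j) / j.+1%:R)).
  apply: cvgM; last exact: cvg_cst.
  by apply: cvgD => //; apply: cvgM.
by apply/funext => n; rewrite /d subrK mulrC mulKf ?pnatr_eq0.
Unshelve. all: by end_near.
Qed.

(** * Asymptotics on the scale of the square root of [n] *)

Let rt n : R := Num.sqrt n%:R.

Lemma rt_gt0 n : (0 < n)%N -> 0 < rt n.
Proof. by move=> n0; rewrite sqrtr_gt0 ltr0n. Qed.

Lemma sqr_rt n : rt n ^+ 2 = n%:R.
Proof. by rewrite sqr_sqrtr ?ler0n. Qed.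

Lemma cvg_inv_rt : (rt n)^-1 @[n --> \oo] --> 0.
Proof.
apply/gtr0_cvgV0; first by exists 1%N => // n /= n0; exact: rt_gt0.
apply/cvgryPge => A; near=> n.
rewrite (le_trans (ler_norm A)) // -sqrtr_sqr ler_sqrt ?ler0n //.
by near: n; exact: nbhs_infty_ger.
Unshelve. all: by end_near.
Qed.

Lemma cvg_truncn_rt a : 0 <= a -> (Num.truncn (a * rt n))%:R / rt n @[n --> \oo] --> a.
Proof.
move=> a0.
apply: (@squeeze_cvgr _ _ _ _ (fun n => a - (rt n)^-1) (fun=> a)); last 2 first.
- rewrite -[X in _ --> X]subr0; apply: cvgB; [exact: cvg_cst|exact: cvg_inv_rt].
- exact: cvg_cst.
exists 1%N => // n /= n0; have r0 := rt_gt0 n0.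
have /andP[h1 h2] := truncn_itv (mulr_ge0 a0 (ltW r0)).
rewrite ler_pdivlMr // ler_pdivrMr // h1 andbT mulrBl mulVf ?gt_eqF // lerBlDr natr1.
exact: ltW.
Qed.

Lemma cvg_div_n (s : nat -> nat) (a : R) : (s n)%:R / rt n @[n --> \oo] --> a ->
  (s n)%:R / n%:R @[n --> \oo] --> (0 : R).
Proof.
move=> sa; rewrite -(mulr0 a).
rewrite (_ : (fun n => _) = (fun n => (s n)%:R / rt n * (rt n)^-1)).
  by apply: cvgM => //; exact: cvg_inv_rt.
by apply/funext => n; rewrite -(sqr_rt n) expr2 invfM mulrA.
Qed.

Lemma cvg_cube_div (s : nat -> nat) (a : R) : (s n)%:R / rt n @[n --> \oo] --> a ->
  (s n)%:R ^+ 3 / n%:R ^+ 2 @[n --> \oo] --> (0 : R).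
Proof.
move=> sa; rewrite -(mulr0 (a * (a * a))).
rewrite (_ : (fun n => _) = (fun n => (s n)%:R / rt n * ((s n)%:R / rt n * ((s n)%:R / rt n)) *
  (rt n)^-1)).
  apply: cvgM; last exact: cvg_inv_rt.
  by apply: cvgM => //; exact: cvgM.
apply/funext => n; rewrite -(sqr_rt n) -exprM (_ : (2 * 2 = 4)%N) // -exprVn.
by ring.
Qed.

Lemma cvg_ltn (s : nat -> nat) (a : R) : (s n)%:R / rt n @[n --> \oo] --> a ->
  \forall n \near \oo, (s n < n)%N.
Proof.
move=> /cvg_div_n s0.
have s1 : \forall n \near \oo, (s n)%:R / n%:R < 1 :> R by exact: (cvgr_lt 0).
near=> n; have n0 : (0 < n)%N by near: n; exists 1%N.
rewrite -(ltr_nat R) -[ltRHS]mul1r -ltr_pdivrMr ?ltr0n //.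
by near: n.
Unshelve. all: by end_near.
Qed.

(** The continuous counterpart of truncated subtraction; written with the norm so that limits pass
    through it. *)
Definition pos_part (x : R) : R := (x + `|x|) / 2.

Lemma cvg_subn (s m : nat -> nat) (a b : R) :
  (s n)%:R / rt n @[n --> \oo] --> a -> (m n)%:R / rt n @[n --> \oo] --> b ->
  (s n - m n)%N%:R / rt n @[n --> \oo] --> pos_part (a - b).
Proof.
move=> sa mb.
rewrite (_ : (fun n => _) = (fun n => pos_part ((s n)%:R / rt n - (m n)%:R / rt n))).
  have sm : (s n)%:R / rt n - (m n)%:R / rt n @[n --> \oo] --> a - b by exact: cvgB.
  apply: cvgM; last exact: cvg_cst.
  by apply: cvgD => //; exact: cvg_norm.
apply/funext => n; rewrite /pos_part -mulrBl normrM (@ger0_norm _ (rt n)^-1).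
  rewrite -mulrDl mulrAC; congr (_ * _).
  case: (leqP (m n) (s n)) => h.
    by rewrite ger0_norm ?subr_ge0 ?ler_nat // natrB //; field.
  rewrite ltr0_norm ?subr_lt0 ?ltr_nat // subrr mul0r.
  by have -> : (s n - m n = 0)%N by lia.
by rewrite invr_ge0 sqrtr_ge0.
Qed.

Lemma sum_subn s k : \sum_(0 <= c < k) (s - c)%:R =
  ((s%:R * (s%:R + 1)) - (s - k)%:R * ((s - k)%:R + 1)) / 2 :> R.
Proof.
elim: k => [|k IH]; first by rewrite big_geq // subn0 subrr mul0r.
rewrite big_nat_recr //= IH; case: (leqP s k) => h.
  have -> : (s - k = 0)%N by lia.
  have -> : (s - k.+1 = 0)%N by lia.
  by field.
have -> : (s - k = (s - k.+1).+1)%N by lia.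
by rewrite -natr1; field.
Qed.

Lemma cvg_tri (x : nat -> nat) (a : R) : (x n)%:R / rt n @[n --> \oo] --> a ->
  (x n)%:R * ((x n)%:R + 1) / n%:R @[n --> \oo] --> a ^+ 2.
Proof.
move=> xa; rewrite expr2 -[X in a * X]addr0.
rewrite (_ : (fun n => _) = (fun n => (x n)%:R / rt n * ((x n)%:R / rt n + (rt n)^-1))).
  by apply: cvgM => //; apply: cvgD => //; exact: cvg_inv_rt.
apply/funext => n; rewrite -(sqr_rt n) expr2 invfM; ring.
Qed.

Lemma hit_itv n s c : 0 <= hit R n s c <= s%:R / n%:R.
Proof.
by rewrite hit_ge0 /= ler_wpM2r ?invr_ge0 ?ler0n // ler_nat leq_subr.
Qed.

(** The limit is the integral of [pos_part (a - x)] over [0 <= x <= b], the Poisson mean of the low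
    arrivals. *)
Lemma cvg_sum_hit_low (s m : nat -> nat) (a b : R) :
  (s n)%:R / rt n @[n --> \oo] --> a -> (m n)%:R / rt n @[n --> \oo] --> b ->
  \sum_(c <- index_iota 0 (m n)) hit R n (s n) c @[n --> \oo] -->
    (a ^+ 2 - pos_part (a - b) ^+ 2) / 2.
Proof.
move=> sa mb; have d := cvg_subn sa mb.
rewrite (_ : (fun n => _) = (fun n => ((s n)%:R * ((s n)%:R + 1) / n%:R -
   (s n - m n)%N%:R * ((s n - m n)%N%:R + 1) / n%:R) / 2)).
  apply: cvgM; last exact: cvg_cst.
  by apply: cvgB; exact: cvg_tri.
apply/funext => n; rewrite /hit -mulr_suml sum_subn; ring.
Qed.

(** The limit is the integral of [pos_part (a - x)] over [x >= b]; the range up to [n] eventually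
    reaches past [s n], where the terms are 0. *)
Lemma cvg_sum_hit_high (s m : nat -> nat) (a b : R) :
  (s n)%:R / rt n @[n --> \oo] --> a -> (m n)%:R / rt n @[n --> \oo] --> b ->
  \sum_(c <- index_iota (m n) n) hit R n (s n) c @[n --> \oo] -->
    pos_part (a - b) ^+ 2 / 2.
Proof.
move=> sa mb; have d := cvg_subn sa mb; have sn := cvg_ltn sa.
apply: cvg_trans (near_eq_cvg _) (_ : (fun n => (s n - m n)%N%:R *
   ((s n - m n)%N%:R + 1) / n%:R / 2) @ \oo --> _); last first.
  by apply: cvgM; [exact: cvg_tri|exact: cvg_cst].
near=> n; have h : (s n < n)%N by near: n.
rewrite /hit -mulr_suml -[X in index_iota X _]add0n big_addn.
rewrite (eq_bigr (fun c => (s n - m n - c)%:R)); last by move=> c _; rewrite addnC subnDA.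
rewrite sum_subn (_ : (s n - m n - (n - m n) = 0)%N); last by lia.
ring.
Unshelve. all: by end_near.
Qed.

Lemma cvg_no_low_prob (s m : nat -> nat) (a b : R) :
  (s n)%:R / rt n @[n --> \oo] --> a -> (m n)%:R / rt n @[n --> \oo] --> b ->
  no_low_prob R n (m n) (s n) @[n --> \oo] -->
    expR (- ((a ^+ 2 - pos_part (a - b) ^+ 2) / 2)).
Proof.
move=> sa mb; rewrite (_ : (fun n => _) =
  (fun n => \prod_(c <- index_iota 0 (m n)) (1 - hit R n (s n) c))).
  apply: (@cvg_prod_1sub _ _ (fun n => (s n)%:R / n%:R)) => [n c| |].
  - exact: hit_itv.
  - exact: cvg_div_n sa.
  - exact: cvg_sum_hit_low.
by apply/funext => n; rewrite big_mkord.
Qed.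

Lemma cvg_coef_highs_pgf (s m : nat -> nat) (a b : R) j :
  (s n)%:R / rt n @[n --> \oo] --> a -> (m n)%:R / rt n @[n --> \oo] --> b ->
  exists x : R, ((highs_pgf R n (m n) (s n))`_j : R) @[n --> \oo] --> x.
Proof.
move=> sa mb.
apply: (@cvg_coef_pgf (fun n => index_iota (m n) n) (fun n c => hit R n (s n) c)
  (fun n => (s n)%:R / n%:R)) => [n c| |].
- exact: hit_itv.
- exact: cvg_div_n sa.
- exact: cvg_sum_hit_high sa mb.
Qed.

(* The one-step operator is triangular with the eigenvalues [1 - i/n], and its
   eigenvectors do not depend on [n]. *)
Lemma stay_spectral K j : exists a : nat -> R, (forall i, (i <= j)%N -> a i = 0) /\
  forall n s, (0 < n)%N ->
  stay R n K s j = \sum_(i < K.+1) a i * (1 - i%:R / n%:R) ^+ s.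
Proof.
have [d] := ubnP (K - j); elim: d j => // d IH j dj.
have [Kj|jK] := leqP K j.
  exists (fun=> 0); split => // n s n0; rewrite stay_out // big1 // => i _; exact: mul0r.
have [|a [a0 ha]] := IH j.+1; first by lia.
(* For the coefficients the recursion of [stay] reads [c i * (j.+1 - i) = j.+1 * a i]. It leaves the
   one at [i = j.+1] free, and the value 1 at [s = 0] fixes it. *)
pose b i : R := if i == j.+1 then 0 else j.+1%:R * a i / (j.+1%:R - i%:R).
pose c i : R := b i + (if i == j.+1 then 1 - \sum_(i < K.+1) b i else 0).
exists c; split => [i ij|n s n0].
  have ne : i == j.+1 = false by apply/eqP; lia.
  by rewrite /c /b ne a0 ?mulr0 ?mul0r ?addr0 //; lia.
elim: s => [|s IHs].
  rewrite /= jK (eq_bigr (fun i : 'I__ => c i)); last by move=> i _; rewrite expr0 mulr1.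
  rewrite /c big_split /= -(big_mkcond (fun i : 'I__ => (i : nat) == j.+1)).
  rewrite [X in _ + X](big_pred1 (Ordinal (jK : (j.+1 < K.+1)%N))); last first.
    by move=> i; rewrite /= -val_eqE.
  by rewrite addrC subrK.
rewrite /= IHs ha // !mulr_sumr -big_split; apply: eq_bigr => /= i _.
have n0' : n%:R != 0 :> R by rewrite pnatr_eq0 -lt0n.
set x := 1 - i%:R / n%:R; rewrite exprS.
suff ci : c i * (j.+1%:R - i%:R) = j.+1%:R * a i.
  have -> : j.+1%:R / n%:R * (a i * x ^+ s) = (j.+1%:R * a i) / n%:R * x ^+ s by ring.
  by rewrite -ci /x; ring.
rewrite /c /b; case: eqP => [->|/eqP ne]; first by rewrite subrr mulr0 a0 ?mulr0.
by rewrite addr0 divfK // subr_eq0 eqr_nat eq_sym.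
Qed.

(** By the spectral formula [n] enters only through finitely many powers [(1 - i/n) ^ (n - T n)],
    which tend to [exp(-i)]. *)
Lemma cvg_stay (T : nat -> nat) K j : (T n)%:R / n%:R @[n --> \oo] --> (0 : R) ->
  exists x : R, stay R n K (n - T n) j @[n --> \oo] --> x.
Proof.
move=> T0; have [a [_ ha]] := stay_spectral K j.
have Tn : \forall n \near \oo, (T n < n)%N.
  have s1 : \forall n \near \oo, (T n)%:R / n%:R < 1 :> R by exact: (cvgr_lt 0).
  near=> n; have n0 : (0 < n)%N by near: n; exists 1%N.
  rewrite -(ltr_nat R) -[ltRHS]mul1r -ltr_pdivrMr ?ltr0n //.
  by near: n.
have inv0 : (n%:R^-1 : R) @[n --> \oo] --> 0.
  rewrite -(mulr0 0) (_ : (fun n => _) = (fun n => (rt n)^-1 * (rt n)^-1)).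
    by apply: cvgM; exact: cvg_inv_rt.
  by apply/funext => n; rewrite -(sqr_rt n) expr2 invfM.
have pow (i : nat) : (1 - i%:R / n%:R : R) ^+ (n - T n) @[n --> \oo] -->
    expR (- i%:R : R).
  rewrite (_ : (fun n => _) =
    (fun n => \prod_(c <- index_iota 0 (n - T n)) (1 - i%:R / n%:R))); last first.
    by apply/funext => n; rewrite big_const_nat iter_mulr_1 subn0.
  apply: (@cvg_prod_1sub (fun n => index_iota 0 (n - T n)) (fun n _ => i%:R / n%:R)
    (fun n => i%:R / n%:R) i%:R).
  - by move=> n _; rewrite lexx divr_ge0 ?ler0n.
  - by rewrite -(mulr0 i%:R); apply: cvgM => //; exact: cvg_cst.
  - apply: cvg_trans (near_eq_cvg _) (_ : (fun n => i%:R * (1 - (T n)%:R / n%:R)) @ \oo --> _).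
      near=> n; have n0 : (0 < n)%N by near: n; exists 1%N.
      have h : (T n < n)%N by near: n.
      rewrite sumr_const_nat subn0 -[_ *+ (n - T n)]mulr_natr natrB ?(ltnW h) //; field.
      by rewrite pnatr_eq0 -lt0n.
    rewrite -[X in _ --> X]mulr1; apply: cvgM; first exact: cvg_cst.
    by rewrite -[X in _ --> X]subr0; apply: cvgB => //; exact: cvg_cst.
exists (\sum_(i < K.+1) a i * expR (- i%:R)).
apply: cvg_trans (near_eq_cvg _)
  (_ : (fun n => \sum_(i < K.+1) a i * (1 - i%:R / n%:R) ^+ (n - T n)) @ \oo --> _).
  by near=> n; rewrite ha //; near: n; exists 1%N.
apply: cvg_big => [|i _]; first exact: add_continuous.
by apply: cvgM => //; exact: cvg_cst.
Unshelve. all: by end_near.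
Qed.

Lemma cvg_highs_mean (s m T : nat -> nat) K (a b : R) :
  (s n)%:R / rt n @[n --> \oo] --> a -> (m n)%:R / rt n @[n --> \oo] --> b ->
  (T n)%:R / n%:R @[n --> \oo] --> (0 : R) ->
  exists x : R, highs_mean n K (m n) (stay R n K (n - T n)) (s n) @[n --> \oo] --> x.
Proof.
move=> sa mb T0.
have [x hx] := choice (fun j => cvg_coef_highs_pgf j sa mb).
have [y hy] := choice (fun j => @cvg_stay T K j T0).
exists (\sum_(j < K) x j * y j).
apply: cvg_big => [|i _]; first exact: add_continuous.
by apply: cvgM.
Qed.

End Limits.

(** * Convergence and lower bound for a fixed number of top positions *)

Section TopCards.
Variable R : realType.
Local Notation rt n := (Num.sqrt n%:R : R).

Definition low_first (M : R) (K n : nat) : R := Ex (fun v : {ffun 'I_n -> 'I_n} =>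
  (first_low n (parent v) (Num.truncn (M * rt n)) n < K)%N%:R).

(** For a fixed grid the lower sandwich sum converges in [n]; [x] is its limit and depends on [eps].
    The gap, [G N] and the bad event together cost less than [eps]. *)
Lemma low_first_cauchy M K eps : 0 < M -> 0 < eps ->
  exists x, \forall n \near \oo, `|x - low_first M K n| < eps.
Proof.
move=> M0 eps0.
(* The bound on the sandwich gap then tends to [M * del = eps / 8]. *)
pose del := eps / 8 / M.
have del0 : 0 < del by rewrite !divr_gt0.
(* The horizon [N * del] covers all low cards and makes it unlikely that none of them has
   arrived. *)
have [N [NM Nexp]] : exists N : nat, M <= N%:R * del /\
    expR (- (M * (N%:R * del) - M ^+ 2 / 2)) < eps / 8.
  have e8 : 0 < eps / 8 by rewrite divr_gt0.
  set B := Num.max M ((M ^+ 2 / 2 - ln (eps / 8)) / M + 1).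
  have [N hN] : exists N : nat, B <= N%:R * del.
    exists (Num.truncn (B / del)).+1.
    by rewrite -ler_pdivrMr // ltW // truncnS_gt.
  exists N; split; first by rewrite (le_trans _ hN) // le_max lexx.
  rewrite -[X in _ < X]lnK ?posrE // ltr_expR ltrNl.
  have : (M ^+ 2 / 2 - ln (eps / 8)) / M < N%:R * del.
    apply: lt_le_trans hN; rewrite lt_max; apply/orP; right.
    by rewrite ltrDl.
  by rewrite ltr_pdivrMr // => h; lra.
pose m n := Num.truncn (M * rt n).
pose t n i := Num.truncn (i%:R * del * rt n).
pose T n := t n N.
have lim_t i : (t n i)%:R / rt n @[n --> \oo] --> i%:R * del.
  by apply: cvg_truncn_rt; rewrite mulr_ge0 ?ler0n // ltW.
have lim_m : (m n)%:R / rt n @[n --> \oo] --> M by apply: cvg_truncn_rt; exact: ltW.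
have T0 : (T n)%:R / n%:R @[n --> \oo] --> (0 : R) by exact: cvg_div_n (lim_t N).
have Tlt := cvg_ltn (lim_t N).
have t0 n : t n 0%N = 0%N by rewrite /t !mul0r truncn0.
have tS n i : (t n i <= t n i.+1)%N.
  by apply: le_truncn; rewrite !ler_wpM2r ?sqrtr_ge0 ?ler_nat // ltW.
have mT n : (m n <= T n)%N.
  by apply: le_truncn; rewrite ler_wpM2r ?sqrtr_ge0.
pose G i n := no_low_prob R n (m n) (t n i).
pose psi i n := highs_mean n K (m n) (stay R n K (n - T n)) (t n i).
have limG i : G i n @[n --> \oo] -->
   expR (- (((i%:R * del) ^+ 2 - pos_part (i%:R * del - M) ^+ 2) / 2)).
  by exact: cvg_no_low_prob.
have [y lim_psi] := choice (fun i => cvg_highs_mean K (lim_t i) lim_m T0).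
have [x lim_lo] : exists x : R,
    \sum_(i < N) (G i n - G i.+1 n) * psi i.+1 n @[n --> \oo] --> x.
  eexists; apply: cvg_big => [|i _]; first exact: add_continuous.
  by apply: cvgM; [apply: cvgB; exact: limG|exact: lim_psi].
have lim_bad : (T n)%:R ^+ 3 / n%:R ^+ 2 @[n --> \oo] --> (0 : R).
  exact: cvg_cube_div (lim_t N).
have lim_gap : (m n)%:R / rt n * (del + (rt n)^-1) @[n --> \oo] --> M * (del + 0).
  by apply: cvgM => //; apply: cvgD; [exact: cvg_cst|exact: cvg_inv_rt].
have GN : expR (- (((N%:R * del) ^+ 2 - pos_part (N%:R * del - M) ^+ 2) / 2)) < eps / 8.
  apply: le_lt_trans Nexp; rewrite ler_expR /pos_part ger0_norm ?subr_ge0 //.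
  by rewrite le_eqVlt; apply/orP; left; apply/eqP; field.
have gap8 : M * (del + 0) < eps / 4.
  by rewrite addr0 /del mulrC divfK ?gt_eqF //; lra.
have e8 : 0 < eps / 8 by rewrite divr_gt0.
have nearG : \forall n \near \oo, G N n < eps / 8 by exact: (cvgr_lt _ (limG N)).
have near_gap : \forall n \near \oo, (m n)%:R / rt n * (del + (rt n)^-1) < eps / 4.
  exact: (cvgr_lt _ lim_gap).
have near_bad : \forall n \near \oo, (T n)%:R ^+ 3 / n%:R ^+ 2 < eps / 8.
  exact: (cvgr_lt _ lim_bad).
have near_lo : \forall n \near \oo,
    `|x - \sum_(i < N) (G i n - G i.+1 n) * psi i.+1 n| < eps / 8.
  by move/cvgrPdist_lt: lim_lo; apply.
exists x; near=> n.
have n0 : (0 < n)%N by near: n; exists 1%N.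
have r0 : 0 < rt n by rewrite sqrtr_gt0 ltr0n.
have Kn : (K <= n)%N by near: n; exists K.
have Tn : (T n < n)%N by near: n.
have lower := @sandwich_lower R n K (m n) (T n) N (t n) Kn (mT n) Tn (t0 n) erefl (tS n).
have upper := @sandwich_upper R n K (m n) (T n) N (t n) Kn (mT n) Tn (t0 n) erefl (tS n).
have gap := @sandwich_gap R n K (m n) (T n) N (t n) Kn (mT n) Tn (t0 n) erefl (tS n).
(* Truncation can lengthen a block by one, whence the [.+1]. *)
have tD i : (t n i.+1 - t n i <= (Num.truncn (del * rt n)).+1)%N.
  have h1 := truncn_itv (mulr_ge0 (mulr_ge0 (ler0n R i) (ltW del0)) (ltW r0)).
  have h2 := truncn_itv (mulr_ge0 (mulr_ge0 (ler0n R i.+1) (ltW del0)) (ltW r0)).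
  have h3 := truncn_itv (mulr_ge0 (ltW del0) (ltW r0)).
  rewrite -/(t n i) -/(t n i.+1) in h1 h2.
  rewrite leq_subLR -ltnS -(ltr_nat R) addnS -addSn -addnS natrD.
  case/andP: h2 => h2 _; apply: le_lt_trans h2 _.
  case/andP: h1 => _ h1; case/andP: h3 => _ h3.
  by rewrite -natr1 mulrDl mul1r mulrDl ltrD.
have {}gap := gap _ (fun i _ => tD i).
have gapE : (m n)%:R * (Num.truncn (del * rt n)).+1%:R / n%:R <=
    (m n)%:R / rt n * (del + (rt n)^-1).
  have -> : (m n)%:R / rt n * (del + (rt n)^-1) = (m n)%:R * (del * rt n + 1) / n%:R.
    have : rt n ^+ 2 = n%:R by rewrite sqr_sqrtr ?ler0n.
    by set r := rt n in r0 * => <-; field; rewrite gt_eqF.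
  rewrite ler_wpM2r ?invr_ge0 ?ler0n // ler_wpM2l ?ler0n // -natr1 lerD2r.
  by have /andP[] := truncn_itv (mulr_ge0 (ltW del0) (ltW r0)).
have h1 : G N n < eps / 8 by near: n.
have h2 : (m n)%:R / rt n * (del + (rt n)^-1) < eps / 4 by near: n.
have h3 : (T n)%:R ^+ 3 / n%:R ^+ 2 < eps / 8 by near: n.
have h4 : `|x - \sum_(i < N) (G i n - G i.+1 n) * psi i.+1 n| < eps / 8 by near: n.
move: h4 lower upper gap; rewrite -/(low_first M K n) -/(G _ n).
rewrite /G /psi in h1 *; rewrite !ltr_norml.
move: h1 h2 h3 gapE; rewrite -/(low_first M K n).
set Lo := \sum_(i < N) _; set Hi := \sum_(i < N) _.
move=> h1 h2 h3 gapE /andP[h4 h5] lower upper gap.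
apply/andP; split; lra.
Unshelve. all: by end_near.
Qed.

Lemma low_first_cvg M K : 0 < M -> cvg (low_first M K n @[n --> \oo]).
Proof.
move=> M0; apply/cauchy_cvgP/cauchy_exP => eps eps0.
by have [x hx] := low_first_cauchy K M0 eps0; exists x.
Qed.

Lemma low_first_ge M K : 0 < M ->
  1 - expR (- (M ^+ 2 / 2)) - expR 1 / K.+1%:R <= lim (low_first M K n @[n --> \oo]).
Proof.
move=> M0; pose m n := Num.truncn (M * rt n).
have lim_m : (m n)%:R / rt n @[n --> \oo] --> M by apply: cvg_truncn_rt; exact: ltW.
have limG : no_low_prob R n (m n) (m n) @[n --> \oo] --> expR (- (M ^+ 2 / 2)).
  have := cvg_no_low_prob lim_m lim_m.
  by rewrite subrr /pos_part normr0 addr0 mul0r expr0n subr0.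
have lim_bad : (m n)%:R ^+ 3 / n%:R ^+ 2 @[n --> \oo] --> (0 : R).
  exact: cvg_cube_div lim_m.
pose c : R := expR 1 / K.+1%:R.
have lim_lo : 1 - no_low_prob R n (m n) (m n) - c - (m n)%:R ^+ 3 / n%:R ^+ 2
    @[n --> \oo] --> 1 - expR (- (M ^+ 2 / 2)) - c - 0.
  apply: cvgB => //; apply: cvgB; last exact: cvg_cst.
  by apply: cvgB => //; exact: cvg_cst.
rewrite -[X in X <= _]subr0.
apply: (ler_cvg_to lim_lo (low_first_cvg (K := K) M0)).
have mlt := cvg_ltn lim_m.
near=> n.
have n0 : (0 < n)%N by near: n; exists 1%N.
have Kn : (K <= n)%N by near: n; exists K.
have mn : (m n < n)%N by near: n.
(* A single block, so the horizon is [m n] itself. *)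
pose t i := if i == 0%N then 0%N else m n.
have tS i : (t i <= t i.+1)%N by case: i.
have := @sandwich_lower R n K (m n) (m n) 1 t Kn (leqnn _) mn erefl erefl tS.
rewrite big_ord_recl big_ord0 addr0 /t /= no_low_prob0.
(* No card satisfies [m <= c < v c <= m], so the number of high arrivals by time [m] is 0 and its
   generating function is 1. *)
have -> : highs_mean n K (m n) (stay R n K (n - m n)) (m n) = stay R n K (n - m n) 0.
  have pgf1 : highs_pgf R n (m n) (m n) = 1.
    rewrite /highs_pgf big_nat big1 // => i /andP[mi _].
    by rewrite /hit (_ : (m n - i = 0)%N) ?mul0r ?subr0 ?scale0r ?addr0 //; apply/eqP.
  rewrite /highs_mean pgf1.
  case: (posnP K) => [->|K0]; first by rewrite big_ord0 stay_out.
  rewrite (bigD1 (Ordinal K0)) //= coef1 mul1r big1 ?addr0 // => i i0.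
  by rewrite coef1 (_ : (i == 0 :> nat) = false) ?mul0r //; exact: negPf i0.
apply: le_trans; rewrite lerD2r -/c.
set g := no_low_prob _ _ _ _; set w := stay _ _ _ _ _.
have g0 : 0 <= g by exact: no_low_prob_ge0.
have w1 : w <= 1 by exact: stay_le1.
suff wc : 1 - w <= c.
  have -> : (1 - g) * w = 1 - g - (1 - w) + g * (1 - w) by ring.
  rewrite -[X in X <= _]addr0 lerD ?mulr_ge0 ?subr_ge0 //.
  by rewrite lerD2l lerN2.
apply: le_trans (stay_markov R _ _ Kn n0) _; rewrite mul1r /c.
rewrite ler_wpM2r ?invr_ge0 ?ler0n //.
(* The chain is [(1 + 1/n) ^ (n - m) <= exp((n - m)/n) <= e]. *)
apply: (@le_trans _ _ (expR (n%:R^-1) ^+ (n - m n))).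
  by apply: lerXn2r; rewrite ?nnegrE ?addr_ge0 ?invr_ge0 ?ler0n ?expR_ge0 ?expR_ge1Dx.
rewrite -expRM_natl ler_expR -ler_pdivlMr ?invr_gt0 ?ltr0n // invrK mul1r ler_nat.
exact: leq_subr.
Unshelve. all: by end_near.
Qed.

End TopCards.

(** * The event under both distributions, and total variation *)

Section Distributions.
Variable R : realType.
Local Notation rt n := (Num.sqrt n%:R : R).

(** Composing with a transposition of values matches the permutations sending [j] to [c'] with those
    sending [j] to [c], so the [n] classes are equally large. *)
Lemma card_perm_apply n (j c : 'I_n) :
  (#|[set s : 'S_n | s j == c]%SET| * n = #|'S_n|)%N.
Proof.
have same c' : #|[set s : 'S_n | s j == c']%SET| = #|[set s : 'S_n | s j == c]%SET|.
  rewrite -(card_imset _ (mulIg (tperm c c'))); apply: eq_card => s.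
  apply/imsetP/idP => [[s' + ->]|]; rewrite !inE => /eqP sj.
    by rewrite /= permM sj tpermR.
  exists (s * tperm c c')%g; last by rewrite -mulgA tperm2 mulg1.
  by rewrite inE /= permM sj tpermL.
transitivity (\sum_(c' < n) #|[set s : 'S_n | s j == c']%SET|)%N.
  by rewrite (eq_bigr _ (fun c' _ => same c')) sum_nat_const card_ord mulnC.
rewrite -sum1_card (partition_big (fun s : 'S_n => s j) xpredT) //=.
by apply: eq_bigr => c' _; rewrite -sum1_card; apply: eq_bigl => s; rewrite inE.
Qed.

(** Union bound over [K] positions and [m] cards, each pair having probability [1/n]. *)
Lemma Pr_uniform_low_card n (M L : R) : 0 <= M -> 0 <= L ->
  (Num.truncn L <= n)%N -> (Num.truncn (M * rt n) <= n)%N ->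
  Pr (@uniform_deck R n) (low_card_on_top n M L) <=
    (Num.truncn L)%:R * (Num.truncn (M * rt n))%:R / n%:R.
Proof.
move=> M0 L0; set K := Num.truncn L; set m := Num.truncn _ => Kn mn.
case: (posnP n) => [n0|n0].
  rewrite /Pr big1 ?divr_ge0 ?mulr_ge0 ?ler0n // => s.
  by rewrite inE => /existsP[j]; have := ltn_ord j; rewrite {2}n0.
have N0 : #|'S_n|%:R != 0 :> R by rewrite pnatr_eq0 card_Sn -lt0n fact_gt0.
have n0' : n%:R != 0 :> R by rewrite pnatr_eq0 -lt0n.
rewrite /Pr /uniform_deck.
apply: (@le_trans _ _ (\sum_(j < n | (j < K)%N) \sum_(c < n | (c < m)%N)
    \sum_(s : 'S_n) (s j == c)%:R / #|'S_n|%:R)).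
  have pos (j c : 'I_n) (s : 'S_n) : 0 <= (s j == c)%:R / #|'S_n|%:R :> R.
    by rewrite divr_ge0 ?ler0n.
  rewrite [leRHS](_ : _ = \sum_(s : 'S_n) \sum_(j < n | (j < K)%N)
      \sum_(c < n | (c < m)%N) (s j == c)%:R / #|'S_n|%:R); last first.
    by rewrite [RHS]exchange_big; apply: eq_bigr => j _; rewrite [RHS]exchange_big.
  rewrite big_mkcond; apply: ler_sum => s _.
  case: ifP => [|_]; last by do 2!(apply: sumr_ge0 => ? _).
  rewrite inE => /existsP[j /andP[jL sj]].
  have jK : (j < K)%N by rewrite /K truncn_ge_nat.
  have sm : (s j < m)%N by rewrite /m truncn_ge_nat // mulr_ge0 ?sqrtr_ge0.
  rewrite (bigD1 j) //= (bigD1 (s j)) //= eqxx mul1r.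
  rewrite -addrA lerDl addr_ge0 //; first by apply: sumr_ge0.
  by do 2!(apply: sumr_ge0 => ? _).
rewrite (eq_bigr (fun=> m%:R / n%:R)) => [|j _]; last first.
  rewrite (eq_bigr (fun=> n%:R^-1)) => [|c _].
    by rewrite -(big_ord_widen n (fun=> n%:R^-1)) // sumr_const card_ord mulr_natl.
  have -> : \sum_(s : 'S_n) (s j == c)%:R / #|'S_n|%:R =
      #|[set s : 'S_n | s j == c]%SET|%:R / #|'S_n|%:R :> R.
    rewrite -mulr_suml; congr (_ / _); rewrite -sum1_card natr_sum [RHS]big_mkcond.
    by apply: eq_bigr => s _; rewrite inE; case: eqP.
  rewrite -(card_perm_apply j c) natrM invfM mulrA divff ?mul1r //.
  by apply: contraNneq N0 => e; rewrite -(card_perm_apply j c) natrM e mul0r.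
rewrite -(big_ord_widen n (fun=> m%:R / n%:R)) // sumr_const card_ord.
by rewrite -[_ *+ K]mulr_natl mulrA.
Qed.

Lemma Pr_le1 n (A : {set 'S_n}) : (0 < n)%N -> Pr (@card_cyclic R n 1%g) A <= 1.
Proof.
move=> n0; rewrite -[leRHS](@Ex_cst R n) //.
rewrite -(@Pr_card_cyclic R n predT) /Pr big_mkcond [leRHS]big_mkcond /=.
apply: ler_sum => s _; rewrite [X in _ <= (if X then _ else _)]inE.
by case: ifP => //= _; rewrite divr_ge0 ?ler0n.
Qed.

Lemma Pr_low_card_near (C M : R) : 0 < C -> 0 < M ->
  \forall n \near \oo, Pr (@card_cyclic R n 1%g) (low_card_on_top n M (C * M ^+ 2)) =
    low_first M (Num.truncn (C * M ^+ 2)) n.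
Proof.
move=> C0 M0; near=> n; apply: Pr_low_card; rewrite ?(ltW M0) //.
  by rewrite mulr_ge0 ?sqr_ge0 // ltW.
by near: n; exists (Num.truncn (C * M ^+ 2)).
Unshelve. all: by end_near.
Qed.

Lemma cvg_Pr_low_card (C M : R) : 0 < C -> 0 < M ->
  Pr (@card_cyclic R n 1%g) (low_card_on_top n M (C * M ^+ 2)) @[n --> \oo] -->
  lim (low_first M (Num.truncn (C * M ^+ 2)) n @[n --> \oo]).
Proof.
move=> C0 M0; apply: cvg_trans (near_eq_cvg _) (low_first_cvg (K := _) M0).
near=> n; apply/esym; near: n; exact: Pr_low_card_near.
Unshelve. all: by end_near.
Qed.

(** As [K.+1 > C M^2], both error terms of [low_first_ge] vanish when [M] grows. *)
Lemma cvg_lim_low_first (C : R) : 0 < C ->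
  lim (low_first M (Num.truncn (C * M ^+ 2)) n @[n --> \oo]) @[M --> +oo] --> (1 : R).
Proof.
move=> C0.
apply: (@squeeze_cvgr _ _ _ _
  (fun M => 1 - expR (- (M ^+ 2 / 2)) - expR 1 * (C * M ^+ 2)^-1) (fun=> 1)); last 2 first.
- rewrite -[X in _ --> X]subr0 -[X in _ --> X - _]subr0.
  have sq : (M ^+ 2 : R) @[M --> +oo] --> +oo by exact: cvgr_expr2.
  apply: cvgB; first apply: cvgB; first exact: cvg_cst.
    apply: (@cvg_comp _ _ _ (fun M : R => M ^+ 2 / 2) (fun x => expR (- x)) _ +oo).
      by apply: gt0_cvgMly => //; rewrite invr_gt0.
    exact: cvgr_expR.
  rewrite -[X in _ --> X](mulr0 (expR 1)); apply: cvgM; first exact: cvg_cst.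
  apply/gtr0_cvgV0; last exact: gt0_cvgMry.
  by near=> M; rewrite mulr_gt0 // exprn_gt0 //; near: M; exact: nbhs_pinfty_gt.
- exact: cvg_cst.
near=> M; have M0 : 0 < M by near: M; exact: nbhs_pinfty_gt.
have CM : 0 < C * M ^+ 2 by rewrite mulr_gt0 // exprn_gt0.
apply/andP; split.
  apply: le_trans (low_first_ge _ M0); rewrite lerD2l lerN2 ler_wpM2l ?expR_ge0 //.
  by rewrite lef_pV2 ?posrE ?ltr0n // ltW // truncnS_gt.
apply: limr_le; first exact: low_first_cvg.
near=> n; have n0 : (0 < n)%N by near: n; exists 1%N.
rewrite /low_first -[leRHS](@Ex_cst R n) //; apply: le_Ex => v.
by case: (_ < _)%N.
Unshelve. all: by end_near.
Qed.

Lemma cvg_tv_dist :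
  tv_dist (@card_cyclic R n 1%g) (@uniform_deck R n) @[n --> \oo] --> (1 : R).
Proof.
apply/cvgrPdist_le => eps eps0.
have e3 : 0 < eps / 3 by rewrite divr_gt0.
(* With [C = 1] and this [M], the event has mass above [1 - eps/3] under the shuffle and below
   [eps/3] under the uniform measure for large [n]. *)
have [M [M0 lM]] : exists M : R, 0 < M /\
    1 - eps / 3 < lim (low_first M (Num.truncn (1 * M ^+ 2)) n @[n --> \oo]).
  have lt1 : 1 - eps / 3 < 1 by rewrite ltrBlDr ltrDl.
  have [M M0 lM] := pinfty_ex_gt (real0 R) (cvgr_gt _ (cvg_lim_low_first ltr01) _ lt1).
  by exists M.
have near_p := cvgr_gt _ (cvg_Pr_low_card ltr01 M0) _ lM.
have lim_m := cvg_truncn_rt (ltW M0).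
have near_m := cvg_ltn lim_m.
have near_u : \forall n \near \oo,
    (Num.truncn (1 * M ^+ 2))%:R * ((Num.truncn (M * rt n))%:R / n%:R) < eps / 3 :> R.
  apply: (@cvgr_lt _ _ _ _ _ 0) => //.
  rewrite -[X in _ --> X](mulr0 (Num.truncn (1 * M ^+ 2))%:R).
  by apply: cvgM; [exact: cvg_cst|exact: cvg_div_n lim_m].
near=> n; have n0 : (0 < n)%N by near: n; exists 1%N.
have p1 : 1 - eps / 3 <
  Pr (@card_cyclic R n 1%g) (low_card_on_top n M (1 * M ^+ 2)).
  by near: n; exact: near_p.
have Kn : (Num.truncn (1 * M ^+ 2) <= n)%N.
  by near: n; exists (Num.truncn (1 * M ^+ 2)).
have mn : (Num.truncn (M * rt n) < n)%N by near: n.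
have u0 : (Num.truncn (1 * M ^+ 2))%:R * ((Num.truncn (M * rt n))%:R / n%:R) < eps / 3.
  by near: n.
pose A : set R := range (fun B : {set 'S_n} =>
  Pr (@card_cyclic R n 1%g) B - Pr (@uniform_deck R n) B).
rewrite -[tv_dist _ _]/(sup A).
have A1 : ubound A 1.
  move=> _ [B _ <-]; rewrite (@le_trans _ _ (Pr (@card_cyclic R n 1%g) B)) ?Pr_le1 //.
  by rewrite gerBl sumr_ge0 // => s _; rewrite /uniform_deck invr_ge0 ler0n.
have tv1 : sup A <= 1 by apply: ge_sup => //; eexists; exists finset.set0.
pose B := low_card_on_top n M (1 * M ^+ 2).
have AB : Pr (@card_cyclic R n 1%g) B - Pr (@uniform_deck R n) B <= sup A.
  by apply: ub_le_sup; [exists 1|exists B].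
have u1 : Pr (@uniform_deck R n) B < eps / 3.
  apply: le_lt_trans u0; rewrite mulrA; apply: Pr_uniform_low_card => //.
  - exact: ltW.
  - by rewrite mul1r sqr_ge0.
  - exact: ltnW.
rewrite -/B in p1; rewrite ger0_norm ?subr_ge0 //; lra.
Unshelve. all: by end_near.
Qed.

End Distributions.

Theorem theorem3 (R : realType) :
  (\forall C \near (+oo : set_system R),
     exists l : R -> R,
       (forall M : R, 0 < M ->
          Pr (@card_cyclic R n 1%g) (low_card_on_top n M (C * M ^+ 2))
            @[n --> \oo] --> l M) /\
       (l M @[M --> +oo] --> (1 : R))) /\
  (tv_dist (@card_cyclic R n 1%g) (@uniform_deck R n) @[n --> \oo] --> (1 : R)).
Proof.
split; last exact: cvg_tv_dist.
(* Every positive [C] is large enough. *)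
near=> C; have C0 : 0 < C by near: C; exact: nbhs_pinfty_gt.
exists (fun M => lim (low_first M (Num.truncn (C * M ^+ 2)) n @[n --> \oo])).
split; last exact: cvg_lim_low_first.
by move=> M M0; exact: cvg_Pr_low_card.
Unshelve. all: by end_near.
Qed.
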